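(* Let $n\ge2$ and let $\lambda$ be a strict partition with at most $n$ parts. (a) $T^{\mathsf{highest}}_\lambda$ is the unique $\mathfrak q^+_n$-highest weight element of $\textsf{DecTab}^+_n(\lambda)$. (b) $\hat T^{\mathsf{lowest}}_\lambda$ is the unique $\mathfrak q^+_n$-lowest weight element of $\textsf{DecTab}^+_n(\lambda)$.
   Context: Primed numbers: $i':=i-\tfrac12$, ordered $1'<1<2'<2<\cdots$; adding/subtracting 1 keeps prime status. For a word $w=w_1\cdots w_m$ in $\{1'<1<\dots<n'<n\}$: $\mathsf{wt}(w)_i$ = number of letters in $\{i',i\}$. For $i\in[n-1]$, mark letters in $\{i',i\}$ by '')'' and letters in $\{(i+1)',i+1\}$ by ''(''; $i$-unpaired letters are those not matched in the usual parenthesis matching; $e_i(w)=0$ if no $i$-unpaired letter is in $\{(i+1)',i+1\}$, else subtract 1 from the first such letter; $f_i(w)=0$ if no $i$-unpaired letter is in $\{i',i\}$, else add 1 to the last such letter. $e_0(w)=0$ if $w$ has no $1'$ or a $1$ occurs before the first $1'$, else change the first $1'$ to $1$; $f_0(w)=0$ if $w$ has no $1$ or a $1'$ occurs before the first $1$, else change the first $1$ to $1'$. $e_{\overline1}$: let $j,k$ be minimal with $w_j\in\{2',2\}$, $w_k\in\{1',1\}$; if $j$ does not exist or $j>k$ then $0$; if $j$ exists and $k$ does not, subtract 1 from $w_j$; otherwise replace $w_j$ by $w_k$ and $w_k$ by $w_j-1$. $f_{\overline1}$: let $j<k$ be the two smallest indices with $w_j,w_k\in\{1',1\}$; if $j$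 does not exist or a letter before position $j$ lies in $\{2',2\}$ then $0$; if $j$ exists and $k$ does not, add 1 to $w_j$; otherwise replace $w_j$ by $w_k+1$ and $w_k$ by $w_j$. All operators send $0$ to $0$. Decomposition tableaux. For strict $\lambda=(\lambda_1>\dots>\lambda_\ell>0)$ the shifted diagram is $\mathsf{SD}_\lambda=\{(i,i+j-1):i\in[\ell],j\in[\lambda_i]\}$; row $i$ = boxes $(i,\cdot)$. A hook word is a sequence of positive integers $w_1\cdots w_k$ with $w_1\ge\dots\ge w_p<w_{p+1}<\dots<w_k$ for some $p\in[k]$; its middle element is $w_p$. A decomposition tableau of shape $\lambda$ assigns positive integers to $\mathsf{SD}_\lambda$ so that each row $\rho_i$ (read left to right) is a hook word and $\rho_i$ is a hook subword of maximal length in $\rho_{i+1}\rho_i$ for $i\in[\ell-1]$; a primed decomposition tableau adds primes to the middle elements of some subset of rows. $\textsf{DecTab}^+_n(\lambda)$: primed decomposition tableaux of shape $\lambda$ with entries in $\{1'<\dots<n'<n\}$. $\mathsf{revrow}(T)$ reads row 1 right to left, then row 2 right to left, etc.; $\mathsf{wt}(T)_i$ = number of entries in $\{i',i\}$. For $i\in\{\overline1,0,1,\dots,n-1\}$, $e_i(T)$ is $0$ if $e_i(\mathsf{revrow}(T))=0$ and otherwise the shifted tableau of shape $\lambda$ whose reverse row reading word is $e_i(\mathsf{revrow}(T))$; similarly for $f_i$. (These lie in $\textsf{DecTab}^+_n(\lambda)\sqcup\{0\}$.) Highest/lowest weight. An $i$-string is a connected component of the graph with edges $b\to f_i(b)$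 ($f_i(b)\ne0$); $\sigma_i$ reverses each $i$-string (first $\leftrightarrow$ last, second $\leftrightarrow$ second-to-last, ...), $\sigma_i(0)=0$. For $2\le i\le n-1$: $e_{\overline i}:=(\sigma_{i-1}\sigma_i)\cdots(\sigma_2\sigma_3)(\sigma_1\sigma_2)e_{\overline1}(\sigma_2\sigma_1)(\sigma_3\sigma_2)\cdots(\sigma_i\sigma_{i-1})$, and $f_{\overline i}$ likewise with $f_{\overline1}$. $\sigma_{w_0}:=(\sigma_1)(\sigma_2\sigma_1)\cdots(\sigma_{n-1}\cdots\sigma_1)$, and $f_{\overline i'}:=\sigma_{w_0}e_{\overline{n-i}}\sigma_{w_0}^{-1}$ for $i\in[n-1]$. For $i\in[n]$: $e_0^{[i]}:=\sigma_{i-1}\cdots\sigma_1e_0\sigma_1\cdots\sigma_{i-1}$, $f_0^{[i]}:=\sigma_{i-1}\cdots\sigma_1f_0\sigma_1\cdots\sigma_{i-1}$. An element $b$ is $\mathfrak q^+_n$-highest weight if $e_i(b)=e_{\overline i}(b)=0$ for all $i\in[n-1]$ and $e_0^{[i]}(b)=0$ for all $i\in[n]$; it is $\mathfrak q^+_n$-lowest weight if $f_i(b)=f_{\overline i'}(b)=0$ for all $i\in[n-1]$ and $f_0^{[i]}(b)=0$ for all $i\in[n]$. Special tableaux. The first border strip of $\mathsf{SD}_\lambda$ is the minimal subset $S$ containing $(1,\lambda_1)$ such that if $(i,j)\in S$ and $i\ne j$ then $(i+1,j)\in S$, or $(i,j-1)\in S$ when $(i+1,j)\notin\mathsf{SD}_\lambda$.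 Let $\mathsf{SD}^{(1)}_\lambda$ be it; its complement is empty or $\mathsf{SD}_\mu$ for a strict $\mu$ with one fewer part, and inductively $\mathsf{SD}^{(i+1)}_\lambda$ is the first border strip of $\mathsf{SD}_\lambda\setminus(\mathsf{SD}^{(1)}_\lambda\sqcup\dots\sqcup\mathsf{SD}^{(i)}_\lambda)$. $T^{\mathsf{highest}}_\lambda$ has entry $i$ in all boxes of $\mathsf{SD}^{(i)}_\lambda$. $T^{\mathsf{lowest}}_\lambda$ has all entries of row $i$ equal to $n+1-i$, and $\hat T^{\mathsf{lowest}}_\lambda$ is obtained from it by priming the last (rightmost) entry of each row. *)

(* Defs.v *)
From mathcomp Require Import all_boot.

Set Implicit Arguments.
Unset Strict Implicit.
Unset Printing Implicit Defensive.

(** * Primed words *)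

(** [(i, false)] is the letter i and [(i, true)] is the primed letter i'. *)
Definition letter := (nat * bool)%type.
Definition word := seq letter.

Definition absval (x : letter) : nat := x.1.
Definition primed (x : letter) : bool := x.2.
Definition letter_pred (x : letter) : letter := (x.1.-1, x.2).
Definition letter_succ (x : letter) : letter := (x.1.+1, x.2).
Definition has_absval (i : nat) : pred letter := fun x => absval x == i.

Definition letter0 : letter := (0, false).
Definition letter_at (w : word) (p : nat) : letter := nth letter0 w p.
Definition set_letter (w : word) (p : nat) (x : letter) : word :=
  set_nth letter0 w p x.

(** Parenthesis matching, scanning from left to right: [opens] is the stack of
    positions of the "(" (letters of absolute value i + 1) that are not matched
    so far, [closes] the positions of the ")" (absolute value i) that found no
    partner; both lists are decreasing, and [p] is the current position. *)
Fixpoint scan_unpaired (i : nat) (w : word) (p : nat) (opens closes : seq nat)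
    : seq nat * seq nat :=
  match w with
  | [::] => (opens, closes)
  | x :: w' =>
    if has_absval i.+1 x then scan_unpaired i w' p.+1 (p :: opens) closes
    else if has_absval i x then
      if opens is _ :: opens' then scan_unpaired i w' p.+1 opens' closes
      else scan_unpaired i w' p.+1 [::] (p :: closes)
    else scan_unpaired i w' p.+1 opens closes
  end.

(** Positions of the i-unpaired letters of absolute value i + 1 (resp. i), in
    increasing order. *)
Definition unpaired_open (i : nat) (w : word) : seq nat :=
  rev (scan_unpaired i w 0 [::] [::]).1.
Definition unpaired_close (i : nat) (w : word) : seq nat :=
  rev (scan_unpaired i w 0 [::] [::]).2.

(** ** Crystal operators on words; [None] is the element 0. *)

Definition word_e (i : nat) (w : word) : option word :=
  if unpaired_open i w is p :: _
  then Some (set_letter w p (letter_pred (letter_at w p))) else None.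

Definition word_f (i : nat) (w : word) : option word :=
  if unpaired_close i w is p0 :: ps
  then let p := last p0 ps in
       Some (set_letter w p (letter_succ (letter_at w p)))
  else None.

Definition word_e0 (w : word) : option word :=
  let j := index (1, true) w in
  if ((1, true) \notin w) || ((1, false) \in take j w) then None
  else Some (set_letter w j (1, false)).

Definition word_f0 (w : word) : option word :=
  let j := index (1, false) w in
  if ((1, false) \notin w) || ((1, true) \in take j w) then None
  else Some (set_letter w j (1, true)).

(** [find a w = size w] when no letter of [w] satisfies [a]. *)
Definition word_e1bar (w : word) : option word :=
  let j := find (has_absval 2) w in
  let k := find (has_absval 1) w in
  if ~~ has (has_absval 2) w || (k < j) then None
  else if ~~ has (has_absval 1) w then
    Some (set_letter w j (letter_pred (letter_at w j)))
  else
    Some (set_letter (set_letter w j (letter_at w k)) k (letter_pred (letter_at w j))).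

Definition word_f1bar (w : word) : option word :=
  let j := find (has_absval 1) w in
  let k := j.+1 + find (has_absval 1) (drop j.+1 w) in
  if ~~ has (has_absval 1) w || has (has_absval 2) (take j w) then None
  else if ~~ has (has_absval 1) (drop j.+1 w) then
    Some (set_letter w j (letter_succ (letter_at w j)))
  else
    Some (set_letter (set_letter w j (letter_succ (letter_at w k))) k (letter_at w j)).

(** * Shifted diagrams and fillings *)

Definition strict_partition (la : seq nat) : bool :=
  sorted gtn la && (0 \notin la).

(** The box with [tag b = i] and [tagged b = j] is the (j+1)-st box of row i+1
    of the shifted diagram of [la], at position (i + 1, i + j + 1). *)
Definition box (la : seq nat) : finType :=
  {i : 'I_(size la) & 'I_(nth 0 la i)}.

Definition mkbox (la : seq nat) (i : 'I_(size la)) (j : 'I_(nth 0 la i))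
  : box la := Tagged (fun i : 'I_(size la) => 'I_(nth 0 la i)) j.

Definition coord (la : seq nat) (b : box la) : nat * nat :=
  ((tag b).+1, (tag b + tagged b).+1).

(** Fillings of the shifted diagram by letters of absolute value at most [n].
    The absolute value 0 is excluded in [DecTab]; having it in the codomain
    makes absolute values literal and gives a default value for [Thighest]. *)
Definition filling (n : nat) (la : seq nat) : finType :=
  {ffun box la -> 'I_n.+1 * bool}.

Definition entry n la (T : filling n la) (b : box la) : letter :=
  (val (T b).1, (T b).2).

Definition trow n la (T : filling n la) (i : 'I_(size la)) : word :=
  [seq entry T (mkbox j) | j <- enum 'I_(nth 0 la i)].

Definition unprimed_row n la (T : filling n la) (i : 'I_(size la)) : seq nat :=
  map absval (trow T i).

Definition revrow n la (T : filling n la) : word :=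
  flatten [seq rev (trow T i) | i <- enum 'I_(size la)].

(** * Decomposition tableaux *)

(** The position [p] of the middle element counts from 0. *)
Definition hook_word_at (p : nat) (w : seq nat) : bool :=
  [&& p < size w, sorted geq (take p.+1 w) & sorted ltn (drop p w)].

Definition hook_word (w : seq nat) : Prop := exists p, hook_word_at p w.

(** Subwords need not be contiguous. *)
Definition max_hook_subword (v w : seq nat) : Prop :=
  [/\ hook_word v, subseq v w &
      forall u, hook_word u -> subseq u w -> size u <= size v].

Definition DecTab n la (T : filling n la) : Prop :=
  [/\ forall b, 0 < absval (entry T b),
      forall i, hook_word (unprimed_row T i),
      forall i i' : 'I_(size la), i' = i.+1 :> nat ->
        max_hook_subword (unprimed_row T i)
          (unprimed_row T i' ++ unprimed_row T i) &
      forall b, primed (entry T b) ->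
        hook_word_at (tagged b) (unprimed_row T (tag b))].

(** * Crystal operators on tableaux *)

(** At most one filling has a given reverse row reading word. *)
Definition tab_op n la (op : word -> option word) (T : filling n la)
    : option (filling n la) :=
  if op (revrow T) is Some w then [pick U : filling n la | revrow U == w]
  else None.

Definition tab_e n la (i : nat) : filling n la -> option (filling n la) :=
  tab_op (word_e i).
Definition tab_f n la (i : nat) : filling n la -> option (filling n la) :=
  tab_op (word_f i).
Definition tab_e0 n la : filling n la -> option (filling n la) :=
  tab_op word_e0.
Definition tab_f0 n la : filling n la -> option (filling n la) :=
  tab_op word_f0.
Definition tab_e1bar n la : filling n la -> option (filling n la) :=
  tab_op word_e1bar.
Definition tab_f1bar n la : filling n la -> option (filling n la) :=
  tab_op word_f1bar.

(** * Strings and their reversal *)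

Definition edge (X : finType) (f : X -> option X) : rel X :=
  fun b c => f b == Some c.

Definition crystal_string (X : finType) (f : X -> option X) (b : X) : {set X} :=
  [set c | connect (fun x y => edge f x y || edge f y x) b c].

(** The element of the string of [b] whose position from the start is the
    position of [b] from the end. *)
Definition string_reversal (X : finType) (f : X -> option X) (b : X) : X :=
  odflt b [pick c in crystal_string f b |
    #|[set d | connect (edge f) d c]| == #|[set d | connect (edge f) b d]|].

(** The strings are taken in the graph on all fillings; the decomposition
    tableaux are preserved by the operators and form a union of components. *)
Definition sigma n la (i : nat) : filling n la -> filling n la :=
  string_reversal (@tab_f n la i).

(** [sigmas [:: i1; ...; ik]] is the composite sigma_i1 ... sigma_ik, in which
    sigma_ik acts first. *)
Definition sigmas n la (s : seq nat) (T : filling n la) : filling n la :=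
  foldr (@sigma n la) T s.

Definition conj_op n la (s : seq nat)
    (op : filling n la -> option (filling n la)) (t : seq nat)
    (T : filling n la) : option (filling n la) :=
  omap (sigmas s) (op (sigmas t T)).

(** (i-1) i ... 2 3 1 2 *)
Definition bar_left (i : nat) : seq nat :=
  flatten [seq [:: j; j.+1] | j <- rev (iota 1 i.-1)].
(** 2 1 3 2 ... i (i-1) *)
Definition bar_right (i : nat) : seq nat :=
  flatten [seq [:: j.+1; j] | j <- iota 1 i.-1].

(** Both lists are empty for i = 1. *)
Definition tab_ebar n la (i : nat) : filling n la -> option (filling n la) :=
  conj_op (bar_left i) (@tab_e1bar n la) (bar_right i).
Definition tab_fbar n la (i : nat) : filling n la -> option (filling n la) :=
  conj_op (bar_left i) (@tab_f1bar n la) (bar_right i).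

Definition sigma_w0 n la : filling n la -> filling n la :=
  sigmas (flatten [seq rev (iota 1 k) | k <- iota 1 n.-1]).

(** [finv] is the inverse function, [sigma_w0] being a bijection. *)
Definition tab_fbar' n la (i : nat) (T : filling n la)
    : option (filling n la) :=
  omap (@sigma_w0 n la) (tab_ebar (n - i) (finv (@sigma_w0 n la) T)).

Definition tab_e0_at n la (i : nat) : filling n la -> option (filling n la) :=
  conj_op (rev (iota 1 i.-1)) (@tab_e0 n la) (iota 1 i.-1).
Definition tab_f0_at n la (i : nat) : filling n la -> option (filling n la) :=
  conj_op (rev (iota 1 i.-1)) (@tab_f0 n la) (iota 1 i.-1).

Definition highest_weight n la (T : filling n la) : Prop :=
  (forall i, 1 <= i <= n.-1 -> tab_e i T = None /\ tab_ebar i T = None) /\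
  (forall i, 1 <= i <= n -> tab_e0_at i T = None).

Definition lowest_weight n la (T : filling n la) : Prop :=
  (forall i, 1 <= i <= n.-1 -> tab_f i T = None /\ tab_fbar' i T = None) /\
  (forall i, 1 <= i <= n -> tab_f0_at i T = None).

(** * Border strips and the extremal tableaux *)

Definition coords la (D : {set box la}) : seq (nat * nat) :=
  [seq coord b | b in D].

(** For [D] the shifted diagram of mu, [first_row_length D] is mu_1. *)
Definition first_row_length la (D : {set box la}) : nat :=
  #|[set b in D | (coord b).1 == 1]|.

Definition strip_condition la (D S : {set box la}) : bool :=
  [&& S \subset D, (1, first_row_length D) \in coords S &
    all (fun p => let: (i, j) := p in
           (i != j) ==>
           (if (i.+1, j) \in coords D then (i.+1, j) \in coords S
            else (i, j.-1) \in coords S))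
        (coords S)].

(** No [S] qualifies when [D] is empty, and then the result is empty. *)
Definition first_border_strip la (D : {set box la}) : {set box la} :=
  odflt set0 [pick S : {set box la} | minset (strip_condition D) S].

Fixpoint strips_removed la (k : nat) : {set box la} :=
  if k is k'.+1
  then strips_removed la k' :\: first_border_strip (strips_removed la k')
  else setT.

(** The k-th border strip, for k >= 1. *)
Definition border_strip la (k : nat) : {set box la} :=
  first_border_strip (strips_removed la k.-1).

Definition Thighest n la : filling n la :=
  [ffun b => (odflt ord0 [pick k : 'I_n.+1 | (0 < k) && (b \in border_strip la k)],
              false)].

Definition Tlowest n la : filling n la :=
  [ffun b => (inord (n.+1 - (coord b).1), false)].

Definition Tlowest_hat n la : filling n la :=
  [ffun b : box la =>
     ((Tlowest n la b).1, (tagged b).+1 == nth 0 la (tag b))].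

(* Main.v *)
Require Import Defs.
From mathcomp Require Import all_boot.
From mathcomp Require Import zify.

Set Implicit Arguments.
Unset Strict Implicit.
Unset Printing Implicit Defensive.

(** Write F_i for the maximal power of f_i on words: it turns every unmatched
    letter i into i+1.  The F_i satisfy the 0-Hecke relations, and sigma_i acts
    as F_i at the top of a string.  Hence sigma_w0 carries a gl-highest word u to
    F_w0 u, which only depends on the gl-component of u.  Call a word strictly
    lattice if the weight of each of its prefixes, read from n down to 1, is a
    strict partition.  If moreover all e_(bar i) vanish on u, then F_w0 u is
    strictly lattice: the condition for e_(bar i) says that a certain word
    obtained from u by operators F_j has no letter 2 before its first letter 1,
    and this propagates through the factorization of w0 into the cycles
    s_1 s_2 ... s_k.

    The operators f_i preserve the longest strictly decreasing and the longest
    weakly increasing subwords of every factor, hence decomposition tableaux.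
    In a decomposition tableau whose word is strictly lattice every row is
    constant, which gives T^lowest; so sigma_w0 carries any highest weight
    element to T^lowest up to primes, and it also carries T^highest there.  The
    primes are located at the row starts of the reading word, and they are
    decided by the operators e_0^[i] and f_0^[i], since the first letter 1 after
    applying sigma_1 ... sigma_(i-1) sits at the start of a row. *)

(** * Maximal powers of the lowering operators *)

(** A reversal sigma_i is easy to compute only at the ends of its string, so each composite that
    occurs has to be shown to meet strings at an end at every stage: at tops when starting from a
    gl-highest element ([valid]), at bottoms when starting from a strictly lattice one
    ([tabw_sigma_desc]).

    Words of absolute values and patterns of primes are kept apart. The operators with index i >= 1
    and the reversals never move a prime, so [tabw] carries the whole gl-argument while [tabp] is a
    constant of it; the two together determine a filling.

    The operators for lowest weight involve the inverse of sigma_w0, which is never computed. A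
    gl-lowest element is instead exhibited as sigma_w0 S with S gl-highest, and the condition f_(bar
    i)' = 0 becomes e_(bar (n-i)) S = 0. Both halves of the theorem thus rest on one classification,
    that of the strictly lattice decomposition tableaux. It is also at that end of the component
    that maximality of hooks is easy to verify, and T^highest inherits it through sigma_w0. *)

Definition cnt (i : nat) (w : seq nat) : nat := count_mem i w.
Arguments cnt : simpl never.

Lemma cnt_cons i x w : cnt i (x :: w) = (x == i) + cnt i w.
Proof. by []. Qed.

Lemma cnt_nil i : cnt i [::] = 0. Proof. by []. Qed.

Lemma cnt_cat i v w : cnt i (v ++ w) = cnt i v + cnt i w.
Proof. exact: count_cat. Qed.

Lemma cnt_notin i w : i \notin w -> cnt i w = 0.
Proof. exact: count_memPn. Qed.

Lemma cnt_gt0 i w : (0 < cnt i w) = (i \in w).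
Proof. by rewrite /cnt -has_count has_pred1. Qed.

(* In the next three functions [d] is the number of "(" (letters i+1) read so far
   and still open. *)
Fixpoint depth (i d : nat) (w : seq nat) : nat :=
  if w is x :: w' then
    depth i (if x == i.+1 then d.+1 else if x == i then d.-1 else d) w'
  else d.

Fixpoint unmatched (i d : nat) (w : seq nat) : nat :=
  if w is x :: w' then
    if x == i.+1 then unmatched i d.+1 w'
    else if x == i then (d == 0) + unmatched i d.-1 w'
    else unmatched i d w'
  else 0.

Fixpoint fmax (i d : nat) (w : seq nat) : seq nat :=
  if w is x :: w' then
    if x == i.+1 then x :: fmax i d.+1 w'
    else if x == i then (if d == 0 then i.+1 else x) :: fmax i d.-1 w'
    else x :: fmax i d w'
  else [::].

Lemma depth_cat i d v w : depth i d (v ++ w) = depth i (depth i d v) w.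
Proof. by elim: v d => //= x v IH d; rewrite IH. Qed.

Lemma unmatched_cat i d v w :
  unmatched i d (v ++ w) = unmatched i d v + unmatched i (depth i d v) w.
Proof.
elim: v d => //= x v IH d.
by case: ifP => _; [|case: ifP => _]; rewrite IH ?addnA.
Qed.

Lemma fmax_cat i d v w :
  fmax i d (v ++ w) = fmax i d v ++ fmax i (depth i d v) w.
Proof.
elim: v d => //= x v IH d.
by case: ifP => _; [|case: ifP => _]; rewrite IH.
Qed.

(** A conservation law: each letter i either closes an open bracket or is counted by [unmatched]. *)
Lemma depth_count i d w :
  unmatched i d w + d + cnt i.+1 w = depth i d w + cnt i w.
Proof.
elim: w d => [|x w IH] d /=; first by rewrite !cnt_nil !addn0.
rewrite !cnt_cons; case: (x =P i.+1) => [->|ne1].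
  by have := IH d.+1; lia.
case: (x =P i) => [_|ne2]; last by have := IH d; lia.
by have := IH d.-1; lia.
Qed.

Lemma depth_mono i d d' w : d <= d' -> depth i d w <= depth i d' w.
Proof. by elim: w d d' => //= x w IH d d' le; apply: IH; do 2?case: ifP => _; lia. Qed.

Lemma unmatched_mono i d d' w : d <= d' -> unmatched i d' w <= unmatched i d w.
Proof.
elim: w d d' => //= x w IH d d' le.
case: ifP => _; first exact: IH.
case: ifP => _; last exact: IH.
have := IH d.-1 d'.-1; lia.
Qed.

Lemma fmax_id i d w : unmatched i d w = 0 -> fmax i d w = w.
Proof.
elim: w d => //= x w IH d.
case: (x =P i.+1) => [->|_]; first by move=> /IH ->.
case: (x =P i) => [->|_]; last by move=> /IH ->.
by case: d => [|d] //= /IH ->.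
Qed.

(** A letter raised at depth 0 becomes a new open bracket, so what follows is scanned at depth 1
    instead of 0; by [unmatched_mono] this cannot create unmatched letters. *)
Lemma unmatched_fmax i d w : unmatched i d (fmax i d w) = 0.
Proof.
elim: w d => //= x w IH d.
case: (x =P i.+1) => [->|ne1]; first by rewrite /= eqxx IH.
case: (x =P i) => [->|ne2].
  case: d => [|d] /=; first by have := unmatched_mono i (fmax i 0 w) (leqnSn 0);
    rewrite eqxx IH leqn0 => /eqP.
  by rewrite eqxx IH; case: eqP; lia.
by rewrite /= IH; do 2 (case: eqP => //).
Qed.

Lemma fmax_idem i w : fmax i 0 (fmax i 0 w) = fmax i 0 w.
Proof. by rewrite fmax_id ?unmatched_fmax. Qed.

Lemma fmax_comm i j d e w : i.+1 < j ->
  fmax i d (fmax j e w) = fmax j e (fmax i d w).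
Proof.
move=> ij; elim: w d e => //= x w IH d e.
case: (x =P j.+1) => [->|n1] /=.
  have -> : (j.+1 == i.+1) = false by lia.
  have -> : (j.+1 == i) = false by lia.
  by rewrite /= eqxx IH.
case: (x =P j) => [->|n2] /=.
  have -> : ((if e == 0 then j.+1 else j) == i.+1) = false by case: ifP; lia.
  have -> : ((if e == 0 then j.+1 else j) == i) = false by case: ifP; lia.
  have -> : (j == i.+1) = false by lia.
  have -> : (j == i) = false by lia.
  rewrite /= eqxx; have -> : (j == j.+1) = false by lia.
  by rewrite IH.
case: (x =P i.+1) => [xE|n3] /=.
  have -> : (x == j.+1) = false by lia.
  have -> : (x == j) = false by lia.
  by rewrite IH.
case: (x =P i) => [xE|n4] /=.
  have -> : ((if d == 0 then i.+1 else x) == j.+1) = false by case: ifP; lia.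
  have -> : ((if d == 0 then i.+1 else x) == j) = false by case: ifP; lia.
  by rewrite IH.
have -> : (x == j.+1) = false by lia.
have -> : (x == j) = false by lia.
by rewrite IH.
Qed.

(* The two sides are run in parallel as automata; the counters of the right
   hand side are determined by those of the left hand side. *)
Lemma fmax_braid_gen i d1 d2 d3 w : let m := minn d1 d3 in
  fmax i d3 (fmax i.+1 d2 (fmax i d1 w)) =
  fmax i.+1 (d1 + d2 - m) (fmax i m (fmax i.+1 (d2 + d3 - m) w)) /\
  depth i d3 (fmax i.+1 d2 (fmax i d1 w)) +
    depth i.+1 (d1 + d2 - m) (fmax i m (fmax i.+1 (d2 + d3 - m) w)) =
  depth i d1 w + depth i.+1 (d2 + d3 - m) w.
Proof.
have F1 : (i.+2 == i.+1) = false by lia.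
have F2 : (i.+2 == i) = false by lia.
have F3 : (i.+1 == i) = false by lia.
have F4 : (i.+1 == i.+2) = false by lia.
have F5 : (i == i.+1) = false by lia.
have F6 : (i == i.+2) = false by lia.
elim: w d1 d2 d3 => [|x w IH] d1 d2 d3 m /=; first by split => //; lia.
(* The induction hypothesis with the right-hand counters given by equations, which leaves linear
   arithmetic in each case. The map from (e1, e2, e3) to (c1, c2, c3) is the piecewise linear
   transition map between Lusztig parametrizations for the two reduced words of the longest element
   of S_3. *)
have K e1 e2 e3 c1 c2 c3 : c2 = minn e1 e3 -> c1 = e2 + e3 - c2 ->
  c3 = e1 + e2 - c2 ->
  fmax i e3 (fmax i.+1 e2 (fmax i e1 w)) =
  fmax i.+1 c3 (fmax i c2 (fmax i.+1 c1 w)) /\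
  depth i e3 (fmax i.+1 e2 (fmax i e1 w)) +
    depth i.+1 c3 (fmax i c2 (fmax i.+1 c1 w)) =
  depth i e1 w + depth i.+1 c1 w.
  by move=> -> -> ->; apply: IH.
have KK x' e1 e2 e3 c1 c2 c3 : c2 = minn e1 e3 -> c1 = e2 + e3 - c2 ->
  c3 = e1 + e2 - c2 ->
  x' :: fmax i e3 (fmax i.+1 e2 (fmax i e1 w)) =
  x' :: fmax i.+1 c3 (fmax i c2 (fmax i.+1 c1 w)) /\
  depth i e3 (fmax i.+1 e2 (fmax i e1 w)) +
    depth i.+1 c3 (fmax i c2 (fmax i.+1 c1 w)) =
  depth i e1 w + depth i.+1 c1 w.
  by move=> h1 h2 h3; have [-> ->] := K _ _ _ _ _ _ h1 h2 h3.
clear K IH; rewrite /m {m}.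
case: (x =P i.+2) => [->|n1].
  do 6! rewrite /= ?(F1,F2,eqxx); apply: KK; lia.
case: (x =P i.+1) => [->|n2].
  do 6! rewrite /= ?(F1,F2,F3,F4,F5,F6,eqxx).
  case: (d2 =P 0) => [d20|d20]; case: (d2 + d3 - minn d1 d3 =P 0) => [c10|c10];
    do 6! rewrite /= ?(F1,F2,F3,F4,F5,F6,eqxx); try (exfalso; lia);
  case: (d1 + d2 - minn d1 d3 =P 0) => [c30|c30];
    do 6! rewrite /= ?(F1,F2,F3,F4,F5,F6,eqxx); try (exfalso; lia); try (apply: KK; lia).
case: (x =P i) => [->|n3].
  do 6! rewrite /= ?(F1,F2,F3,F4,F5,F6,eqxx).
  case: (d1 =P 0) => [d10|d10]; case: (minn d1 d3 =P 0) => [c10|c10];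
    do 6! rewrite /= ?(F1,F2,F3,F4,F5,F6,eqxx); try (exfalso; lia);
  case: (d2 =P 0) => [d20|d20]; case: (d1 + d2 - minn d1 d3 =P 0) => [c30|c30];
    do 6! rewrite /= ?(F1,F2,F3,F4,F5,F6,eqxx); try (exfalso; lia); try (apply: KK; lia);
  case: (d3 =P 0) => [d30|d30];
    do 6! rewrite /= ?(F1,F2,F3,F4,F5,F6,eqxx); try (exfalso; lia); try (apply: KK; lia).
do ! (rewrite /= ?(introF eqP n1) ?(introF eqP n2) ?(introF eqP n3)).
exact: KK.
Qed.

(** * The 0-Hecke relations *)

Lemma fmax_braid i w :
  fmax i 0 (fmax i.+1 0 (fmax i 0 w)) = fmax i.+1 0 (fmax i 0 (fmax i.+1 0 w)).
Proof. by have [] := fmax_braid_gen i 0 0 0 w. Qed.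

(** The second half of [fmax_braid_gen] bounds this depth by the sum of the two initial ones. It
    guarantees that the third reversal in sigma_i sigma_(i+1) sigma_i again starts at the top of a
    string. *)
Lemma depth_fmax_fmax i w : depth i 0 w = 0 -> depth i.+1 0 w = 0 ->
  depth i 0 (fmax i.+1 0 (fmax i 0 w)) = 0.
Proof.
by have [_] := fmax_braid_gen i 0 0 0 w => /= h e1 e2; move: h; rewrite e1 e2; lia.
Qed.

(** For k = i - 1 the operator creates closing letters i, for k = i + 1 it destroys opening letters
    i + 1, and otherwise it changes no bracket: highest weight for i survives every F_k with k
    different from i. *)
Lemma depth_fmax_le i k d d' e w : k != i -> d <= d' ->
  depth i d (fmax k e w) <= depth i d' w.
Proof.
move=> ki; elim: w d d' e => //= x w IH d d' e le.
by case: (x =P k.+1) => [->|n1] /=; [|case: (x =P k) => [->|n2] /=];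
  apply: IH; case: (e == 0); repeat (case: eqP => ?); lia.
Qed.

Definition fmaxs (s : seq nat) (w : seq nat) : seq nat :=
  foldr (fun i => fmax i 0) w s.

Lemma fmaxs_cat s t w : fmaxs (s ++ t) w = fmaxs s (fmaxs t w).
Proof. by rewrite /fmaxs foldr_cat. Qed.

Lemma fmaxs_comm s j w : all (fun i => (i.+1 < j) || (j.+1 < i)) s ->
  fmaxs s (fmax j 0 w) = fmax j 0 (fmaxs s w).
Proof.
elim: s => //= i s IH /andP[ij /IH ->].
by case/orP: ij => ij; [rewrite fmax_comm|rewrite -fmax_comm].
Qed.

Lemma depth_fmaxs_le i s w : i \notin s ->
  depth i 0 (fmaxs s w) <= depth i 0 w.
Proof.
elim: s => //= k s IH; rewrite inE negb_or => /andP[ik /IH].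
by apply: leq_trans; apply: depth_fmax_le; rewrite // eq_sym.
Qed.

Definition desc_iota (k : nat) := rev (iota 1 k).

Arguments desc_iota : simpl never.

Lemma desc_iotaS k : desc_iota k.+1 = k.+1 :: desc_iota k.
Proof. by rewrite /desc_iota -[X in iota _ X]addn1 iotaD rev_cat /= add1n. Qed.

Lemma mem_desc_iota k i : (i \in desc_iota k) = (0 < i <= k).
Proof. by rewrite mem_rev mem_iota add1n ltnS. Qed.

(* [w0word 0 k] is the word of the longest element used in [sigma_w0]. *)
Definition w0word (j k : nat) : seq nat :=
  flatten [seq desc_iota i | i <- iota j.+1 (k - j)].

Arguments w0word : simpl never.

Lemma w0word_nil j : w0word j j = [::].
Proof. by rewrite /w0word subnn. Qed.

Lemma w0word_consE j k : j < k -> w0word j k = desc_iota j.+1 ++ w0word j.+1 k.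
Proof. by move=> jk; rewrite /w0word subnS; case: (k - j) (subn_gt0 j k) => //=; lia. Qed.

Lemma w0word_rcons j k : j <= k -> w0word j k.+1 = w0word j k ++ desc_iota k.+1.
Proof.
move=> jk; rewrite /w0word subSn // -[X in iota _ X]addn1 iotaD map_cat flatten_cat /= cats0.
by congr (_ ++ desc_iota _); lia.
Qed.

Lemma mem_w0word j k i : i \in w0word j k -> 0 < i <= k.
Proof.
case/flatten_mapP => l; rewrite mem_iota mem_desc_iota; lia.
Qed.

(** Write D_l for l, l-1, ..., 1. Each l from j+2 to k commutes past D_1, ..., D_(l-2) and joins
    D_(l-1) to form D_l; only far commutations are used, and the factor D_(j+1) is missing from the
    result. *)
Lemma fmaxs_w0word_gen j k w : j < k ->
  fmaxs (iota j.+2 (k - j.+1)) (fmaxs (w0word 0 k.-1) w) =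
  fmaxs (w0word 0 j) (fmaxs (w0word j.+1 k) w).
Proof.
move=> jk; move: {2}(k - j.+1) (erefl (k - j.+1)) => d.
elim: d j jk => [|d IH] j jk dE.
  have -> : k = j.+1 by lia.
  by rewrite subnn w0word_nil.
rewrite dE /=.
have dE' : k - j.+2 = d by lia.
rewrite -dE' IH //; last by lia.
rewrite (w0word_consE (j := j.+1)); last by lia.
rewrite w0word_rcons // desc_iotaS !fmaxs_cat /=.
rewrite -fmaxs_comm ?desc_iotaS //.
by apply/allP => i /mem_w0word; lia.
Qed.

(** A second factorization of w0: the new cycle stands on the left, acting last, whereas
    [w0word_rcons] puts it on the right. The passage from rank k to rank k + 1 in [strict_w0word]
    depends on it. *)
Lemma fmaxs_w0word k w :
  fmaxs (w0word 0 k.+1) w = fmaxs (iota 1 k.+1) (fmaxs (w0word 0 k) w).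
Proof.
rewrite [RHS]/=; have := @fmaxs_w0word_gen 0 k.+1 w isT; rewrite subSS subn0 /= => ->.
by rewrite /w0word subSS subn0.
Qed.

(** Conjugation by a Coxeter cycle shifts simple reflections; the single braid move takes place
    where j meets j + 1, the remaining letters commute. *)
Lemma fmaxs_iota_shift a m j w : a <= j -> j.+1 < a + m ->
  fmaxs (iota a m) (fmax j 0 w) = fmax j.+1 0 (fmaxs (iota a m) w).
Proof.
elim: m a w => [|m IH] a w aj jm /=; first by lia.
have [ja|ja] := ltnP a j.
  by rewrite IH; [apply: fmax_comm|..]; lia.
have -> : j = a by lia.
case: m {IH} jm => [|m] jm /=; first by lia.
rewrite fmaxs_comm; first by rewrite fmax_braid.
by apply/allP => i; rewrite mem_iota; lia.
Qed.

Lemma fmaxs_desc_shift m j w : 0 < j < m ->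
  fmaxs (desc_iota m) (fmax j.+1 0 w) = fmax j 0 (fmaxs (desc_iota m) w).
Proof.
elim: m => [|m IH] jm; first by lia.
rewrite desc_iotaS /=; have [e|jm'] := eqVneq j m; last first.
  by rewrite IH; [symmetry; apply: fmax_comm|]; lia.
subst j; case: m {IH} jm => // m _; rewrite desc_iotaS /=.
rewrite fmaxs_comm; first by rewrite fmax_braid.
by apply/allP => i; rewrite mem_desc_iota; lia.
Qed.

(** The longest element absorbs every generator. F_j travels left through the cycles, losing one
    from its index each time, until it is F_1 next to a final F_1 and disappears by idempotence.
    Hence F_w0 is constant on gl-components. *)
Lemma fmaxs_w0word_r m j w : 0 < j <= m ->
  fmaxs (w0word 0 m) (fmax j 0 w) = fmaxs (w0word 0 m) w.
Proof.
elim: m j w => [|m IH] j w jm; first by lia.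
rewrite w0word_rcons // !fmaxs_cat.
case: j jm => // -[|j] jm.
  by rewrite /desc_iota /= rev_cons -cats1 !fmaxs_cat /= fmax_idem.
by rewrite fmaxs_desc_shift ?IH //; lia.
Qed.

Definition highest_word (m : nat) (w : seq nat) :=
  forall j, 0 < j <= m -> depth j 0 w = 0.

(* Along a valid sequence every string reversal starts at the top of its string. *)
Fixpoint valid (s w : seq nat) : bool :=
  if s is i :: s' then valid s' w && (depth i 0 (fmaxs s' w) == 0) else true.

Lemma valid_cat s t w : valid (s ++ t) w = valid t w && valid s (fmaxs t w).
Proof. by elim: s => [|i s IH] /=; rewrite ?andbT // IH fmaxs_cat andbA. Qed.

Lemma valid_desc m w : highest_word m w -> valid (desc_iota m) w.
Proof.
elim: m => // m IH hw; rewrite desc_iotaS /= IH /=; last by move=> j ?; apply: hw; lia.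
rewrite -leqn0; apply: leq_trans (depth_fmaxs_le _ _) _; first by rewrite mem_desc_iota; lia.
by rewrite hw //; lia.
Qed.

Lemma highest_desc m w : highest_word m.+1 w ->
  highest_word m (fmaxs (desc_iota m.+1) w).
Proof.
move=> hw j /andP[j0 jm].
(* The factors below j do not disturb j and j + 1, the pair F_(j+1) F_j is covered by
   [depth_fmax_fmax], and the factors above j + 1 do not disturb j. *)
have -> : desc_iota m.+1 = rev (iota j.+2 (m - j)) ++ j.+1 :: j :: desc_iota j.-1.
  have -> : m.+1 = j.-1 + (2 + (m - j)) by lia.
  rewrite /desc_iota !iotaD !rev_cat /= -catA /=.
  have -> : 1 + j.-1 = j by lia.
  by rewrite addn2.
rewrite fmaxs_cat; apply/eqP; rewrite -leqn0.
apply: leq_trans (depth_fmaxs_le _ _) _; first by rewrite mem_rev mem_iota; lia.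
rewrite leqn0; apply/eqP; apply: depth_fmax_fmax;
  apply/eqP; rewrite -leqn0; apply: leq_trans (depth_fmaxs_le _ _) _;
  rewrite ?mem_desc_iota ?hw //; lia.
Qed.

Lemma valid_w0word j k w : j <= k -> highest_word k w ->
  valid (w0word j k) w /\ highest_word j (fmaxs (w0word j k) w).
Proof.
elim: k w => [|k IH] w jk hw.
  by have -> : j = 0 by lia.
have [e|ne] := eqVneq j k.+1; first by subst j; rewrite w0word_nil.
rewrite w0word_rcons ?valid_cat ?fmaxs_cat; last by lia.
rewrite valid_desc //=; apply: IH; first by lia.
exact: highest_desc.
Qed.

(* [zigzag 1 i.-1] is [bar_right i]. *)
Definition zigzag a k := flatten [seq [:: j.+1; j] | j <- iota a k].

Arguments zigzag : simpl never.

Lemma mem_zigzag a k i : i \in zigzag a k -> a <= i.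
Proof. by case/flatten_mapP => l; rewrite mem_iota !inE => ? /orP[]/eqP->; lia. Qed.

(** The depth clause is what the next pair of letters needs: after F_a the letter a + 1 is still at
    the top of its string because it was so before. *)
Lemma valid_zigzag a k m w : 0 < a -> a + k <= m -> highest_word m w ->
  valid (zigzag a k) w /\ depth a 0 (fmaxs (zigzag a k) w) = 0.
Proof.
move=> a0 akm hw; elim: k a a0 akm => [|k IH] a a0 akm.
  by split => //=; apply: hw; lia.
have [] := IH a.+1 isT; first by lia.
rewrite /zigzag /= -/(zigzag _ _) => v d1.
have d0 : depth a 0 (fmaxs (zigzag a.+1 k) w) = 0.
  apply/eqP; rewrite -leqn0; apply: leq_trans (depth_fmaxs_le _ _) _.
    by apply/negP => /mem_zigzag; lia.
  by rewrite hw //; lia.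
split; last exact: depth_fmax_fmax.
rewrite v d0 eqxx /= -leqn0.
by apply: leq_trans (depth_fmax_le _ _ _ (leqnn 0)) _; [lia|rewrite d1].
Qed.

Lemma fmaxs_zigzag a k w :
  fmaxs (zigzag a k) w = fmaxs (iota a.+1 k) (fmaxs (iota a k) w).
Proof.
elim: k a => // k IH a; rewrite /zigzag /= -/(zigzag _ _) IH fmaxs_comm //.
by apply/allP => i; rewrite mem_iota; lia.
Qed.

(** * Strictly lattice words *)

(* In every nonempty prefix of the subword of letters i, i+1 the letters i+1 are
   in strict majority; [d] is the excess so far, with d = 0 only before the
   first such letter. *)
Fixpoint strict_at (i d : nat) (w : seq nat) : bool :=
  if w is x :: w' then
    if x == i.+1 then strict_at i d.+1 w'
    else if x == i then (1 < d) && strict_at i d.-1 w'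
    else strict_at i d w'
  else true.

(** For i = 1 this is the vanishing of e_(bar 1), as [word_e1barE] shows. *)
Fixpoint starts_low (i : nat) (w : seq nat) : bool :=
  if w is x :: w' then (x != i.+1) && ((x == i) || starts_low i w') else true.

(** F_k with k = i - 1 only adds letters i, which makes strictness harder; so strictness can be
    pulled back along it. *)
Lemma strict_at_fmax_prev i k d d' e w : i = k.+1 -> d <= d' ->
  strict_at i d (fmax k e w) -> strict_at i d' w.
Proof.
have F1 : (k.+1 == k.+2) = false by lia.
have F2 : (k == k.+2) = false by lia.
have F3 : (k == k.+1) = false by lia.
move=> ->; elim: w d d' e => //= x w IH d d' e le.
case: (x =P k.+1) => [->|n1] /=.
  by rewrite F1 eqxx => /andP[h /IH ->] //; lia.
case: (x =P k) => [->|n2] /=.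
  case: (e == 0); do 3! rewrite /= ?(F1, F2, F3, eqxx); last exact: IH.
  by case/andP=> h; apply: IH; lia.
rewrite (introF eqP n1); case: (x =P k.+2) => n3; exact: IH.
Qed.

Lemma strict_at_fmax_far i k d e w : (i.+1 < k) || (k.+1 < i) ->
  strict_at i d (fmax k e w) = strict_at i d w.
Proof.
move=> far; elim: w d e => //= x w IH d e.
case: (x =P k.+1) => [->|n1] /=; last case: (x =P k) => [->|n2] /=; rewrite ?IH //.
have G1 : (k == i.+1) = false by lia.
have G2 : (k == i) = false by lia.
have G3 : (k.+1 == i.+1) = false by lia.
have G4 : (k.+1 == i) = false by lia.
by case: (e == 0); rewrite ?(G1, G2, G3, G4).
Qed.

Lemma starts_low_fmax_far i k e w : i.+1 < k ->
  starts_low i (fmax k e w) = starts_low i w.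
Proof.
move=> far; elim: w e => //= x w IH e.
case: (x =P k.+1) => [->|n1] /=; last case: (x =P k) => [->|n2] /=; rewrite ?IH //.
have G1 : (k == i.+1) = false by lia.
have G2 : (k == i) = false by lia.
have G3 : (k.+1 == i.+1) = false by lia.
have G4 : (k.+1 == i) = false by lia.
by case: (e == 0); rewrite ?(G1, G2, G3, G4).
Qed.

(** If i + 1 came first, the excess in the image would equal the bracket depth from then on; as the
    depth must return to 0, so would the excess. *)
Lemma strict_starts_low i y : depth i 0 y = 0 -> strict_at i 0 (fmax i 0 y) ->
  starts_low i y.
Proof.
have aux d w : 0 < d -> depth i d w = 0 -> strict_at i d (fmax i d w) = false.
  elim: w d => [|x w IH] d d0 /=; first by lia.
  case: (x =P i.+1) => [->|n1] /=; first by rewrite eqxx; apply: IH.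
  case: (x =P i) => [->|n2] /=; last first.
    by rewrite (introF eqP n1) (introF eqP n2); apply: IH.
  have -> : (d == 0) = false by lia.
  rewrite eqxx; have -> : (i == i.+1) = false by lia.
  by move=> h; case: (ltnP 1 d) => // d1 /=; apply: IH h; lia.
elim: y => //= x y IH.
case: (x =P i.+1) => [->|n1] /=; first by rewrite eqxx => /aux ->.
case: (x =P i) => [_|n2] //=.
by rewrite (introF eqP n1) (introF eqP n2).
Qed.

(** The first letter i is unmatched and raised, which puts the excess one ahead of the bracket
    depth, and it stays ahead. *)
Lemma starts_low_strict i y : starts_low i y -> strict_at i 0 (fmax i 0 y).
Proof.
have aux d e w : d < e -> strict_at i e (fmax i d w).
  elim: w d e => //= x w IH d e de.
  case: (x =P i.+1) => [->|n1] /=; first by rewrite eqxx; apply: IH; lia.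
  case: (x =P i) => [->|n2] /=; last first.
    by rewrite (introF eqP n1) (introF eqP n2); apply: IH.
  case: (d =P 0) => [->|d0] /=; first by rewrite eqxx; apply: IH; lia.
  rewrite eqxx; have -> : (i == i.+1) = false by lia.
  by rewrite IH; lia.
elim: y => //= x y IH /andP[n1].
rewrite (negPf n1); case: (x =P i) => [_|n2] /=.
  by move=> _; rewrite eqxx; apply: aux.
by rewrite (negPf n1) (introF eqP n2).
Qed.

(** Strictness passes from i to i + 1. In the image the excess of i+2 over i+1 is c + e - g, and it
    remains greater than c because the excess e of z stays above the depth g of the second pass. *)
Lemma strict_at_succ i z : strict_at i 0 z ->
  starts_low i (fmax i.+1 0 z) ->
  strict_at i.+1 0 (fmax i 0 (fmax i.+1 0 z)).
Proof.
have F1 : (i.+2 == i.+1) = false by lia.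
have F2 : (i.+2 == i) = false by lia.
have F3 : (i.+1 == i) = false by lia.
have F4 : (i.+1 == i.+2) = false by lia.
have F5 : (i == i.+1) = false by lia.
have F6 : (i == i.+2) = false by lia.
(* e: excess of i+1 over i in z; c, g: depths of the two passes *)
have aux e c g w : g < e -> strict_at i e w ->
    strict_at i.+1 (c + e - g) (fmax i g (fmax i.+1 c w)).
  elim: w e c g => //= x w IH e c g ge.
  have K d' e' c' g' : d' = c' + e' - g' -> g' < e' -> strict_at i e' w ->
    strict_at i.+1 d' (fmax i g' (fmax i.+1 c' w)).
    by move=> ->; apply: IH.
  case: (x =P i.+2) => [->|n1].
    by do 4! rewrite /= ?(F1,F2,F3,F4,F5,F6,eqxx); apply: K; lia.
  case: (x =P i.+1) => [->|n2].
    do 4! rewrite /= ?(F1,F2,F3,F4,F5,F6,eqxx); case: (c =P 0) => c0;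
      do 4! rewrite /= ?(F1,F2,F3,F4,F5,F6,eqxx).
      by apply: K; lia.
    move=> h; have -> /= : 1 < c + e - g by lia.
    by apply: K h; lia.
  case: (x =P i) => [->|n3].
    do 4! rewrite /= ?(F1,F2,F3,F4,F5,F6,eqxx); move=> /andP[e1 h]; case: (g =P 0) => g0;
      do 4! rewrite /= ?(F1,F2,F3,F4,F5,F6,eqxx).
      have -> /= : 1 < c + e - g by lia.
      by apply: K h; lia.
    by apply: K h; lia.
  do ! (rewrite /= ?(introF eqP n1) ?(introF eqP n2) ?(introF eqP n3)).
  exact: K.
(* Strictness of z puts i + 1 before any i. If that letter were matched it would remain and violate
   [starts_low], so it is met at depth c = 0 and starts [aux] with excess 1. *)
suff gen c w : strict_at i 0 w -> starts_low i (fmax i.+1 c w) ->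
    strict_at i.+1 c (fmax i 0 (fmax i.+1 c w)) by apply: gen.
elim: w c => //= x w IH c.
case: (x =P i.+2) => [->|n1].
  by do 4! rewrite /= ?(F1,F2,F3,F4,F5,F6,eqxx); apply: IH.
case: (x =P i.+1) => [->|n2].
  do 4! rewrite /= ?(F1,F2,F3,F4,F5,F6,eqxx); case: (c =P 0) => c0;
    do 4! rewrite /= ?(F1,F2,F3,F4,F5,F6,eqxx) //.
  by move=> h _; have := aux 1 0 0 w isT h; rewrite c0.
case: (x =P i) => [->|n3] //.
do ! (rewrite /= ?(introF eqP n1) ?(introF eqP n2) ?(introF eqP n3)).
exact: IH.
Qed.

Lemma strict_at_fmaxs_far i s w :
  all (fun k => (i.+1 < k) || (k.+1 < i)) s ->
  strict_at i 0 (fmaxs s w) = strict_at i 0 w.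
Proof. by elim: s => //= k s IH /andP[h /IH <-]; rewrite strict_at_fmax_far. Qed.

Lemma starts_low_fmaxs_far i s w : all (fun k => i.+1 < k) s ->
  starts_low i (fmaxs s w) = starts_low i w.
Proof. by elim: s => //= k s IH /andP[h /IH <-]; rewrite starts_low_fmax_far. Qed.

(** Two successive cycles shift every index by 2, so the extra factors end up acting on letters
    greater than 2 only, where they cannot affect the order of the letters 1 and 2. *)
Lemma fmaxs_two_rows_shift k s w : all (fun i => 0 < i <= k) s ->
  exists2 t, all (fun i => 2 < i) t &
    fmaxs (iota 2 k.+1) (fmaxs (iota 1 k.+1) (fmaxs s w)) =
    fmaxs t (fmaxs (iota 2 k.+1) (fmaxs (iota 1 k.+1) w)).
Proof.
elim: s => [|i s IH]; first by exists [::].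
move=> /andP[ik /IH[t ht e]]; exists (i.+2 :: t); first by rewrite /= ht; lia.
have -> : fmaxs (i :: s) w = fmax i 0 (fmaxs s w) by [].
by rewrite fmaxs_iota_shift; [rewrite fmaxs_iota_shift; [by rewrite e|..]|..]; lia.
Qed.

(** This turns the condition for e_(bar (k+1)), stated on a zigzag image of w, into one on the image
    under F_w0 of rank k that the induction of [strict_w0word] meets. *)
Lemma starts_low_zigzag k w : starts_low 1 (fmaxs (zigzag 1 k) w) ->
  starts_low 1 (fmaxs (iota 2 k) (fmaxs (w0word 0 k) w)).
Proof.
rewrite fmaxs_zigzag; case: k => // k.
rewrite fmaxs_w0word => h.
have [|t ht ->] := @fmaxs_two_rows_shift k (w0word 0 k) w.
  by apply/allP => i; apply: mem_w0word.
by rewrite starts_low_fmaxs_far.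
Qed.

(** Induction on k, and inside on j. The hypothesis on e_(bar (k+1)) gives j = 1; [strict_at_succ]
    then leads from j to j + 1, using strictness in rank k as well. *)
Theorem strict_w0word m w : highest_word m w ->
  (forall k, k < m -> starts_low 1 (fmaxs (zigzag 1 k) w)) ->
  forall k, k <= m -> forall j, 0 < j <= k ->
  strict_at j 0 (fmaxs (w0word 0 k) w).
Proof.
move=> hw low; elim=> [|k IHk] km j; first by lia.
(* [Y k.+2] is the word of rank k, [Y 1] the word of rank k + 1, and [Y i] the stage reached once
   F_(k+1), ..., F_i have acted. *)
pose Y i := fmaxs (iota i (k.+2 - i)) (fmaxs (w0word 0 k) w).
have YS i : 0 < i <= k.+1 -> Y i = fmax i 0 (Y i.+1).
  by move=> ik; rewrite /Y subSn; last by lia.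
have bE : fmaxs (w0word 0 k.+1) w = Y 1 by rewrite fmaxs_w0word /Y subn1.
have split i : 0 < i <= k.+1 -> Y 1 = fmaxs (iota 1 i.-1) (Y i).
  move=> ik; rewrite /Y -[RHS]fmaxs_cat; congr (fmaxs _ _).
  have -> : k.+2 - 1 = i.-1 + (k.+2 - i) by lia.
  by rewrite iotaD; congr (_ ++ iota _ _); lia.
have dY i : 0 < i <= k.+1 -> depth i 0 (Y i.+1) = 0.
  move=> ik; have -> : Y i.+1 = fmaxs (w0word 0 i.-1) (fmaxs (w0word i k.+1) w).
    have := @fmaxs_w0word_gen i.-1 k.+1 w; rewrite /Y prednK; last by lia.
    by move=> <- //; lia.
  apply/eqP; rewrite -leqn0; apply: leq_trans (depth_fmaxs_le _ _) _.
    by apply/negP => /mem_w0word; lia.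
  have [||_ ->] // := @valid_w0word i k.+1 w; try lia.
  by move=> j' hj'; apply: hw; lia.
rewrite bE; case: j => // j; elim: j => [|j IH] jk.
  rewrite YS //; apply: starts_low_strict.
  by rewrite /Y subSS subSS subn0; apply: starts_low_zigzag; apply: low; lia.
have sj : strict_at j.+1 0 (Y 1) by apply: IH; lia.
(* The factors F_1, ..., F_j are stripped off: the last one could only have harmed strictness at j +
   1, the others do not touch the letters j+1 and j+2. *)
have sj' : strict_at j.+1 0 (Y j.+1).
  move: sj; rewrite (split j.+1) //; last by lia.
  case: (j) => // j'; rewrite -[j'.+2.-1]addn1 iotaD fmaxs_cat /= add1n.
  rewrite strict_at_fmaxs_far; first exact: strict_at_fmax_prev.
  by apply/allP => i; rewrite mem_iota; lia.
have lowY : starts_low j.+1 (Y j.+2).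
  by apply: strict_starts_low; [apply: dY; lia|rewrite -YS //; lia].
have sz : strict_at j.+1 0 (Y j.+3).
  rewrite /Y strict_at_fmaxs_far; first by apply: IHk; lia.
  by apply/allP => i; rewrite mem_iota; lia.
rewrite (split j.+1); last by lia.
rewrite strict_at_fmaxs_far.
  rewrite YS ?(YS j.+2); try lia.
  by apply: strict_at_succ => //; rewrite -YS //; lia.
by apply/allP => i; rewrite mem_iota; lia.
Qed.

(** * Strings *)

Section Strings.

Variables (X : finType) (f g : X -> option X) (h : X -> nat).
Hypothesis fg : forall x y, f x = Some y <-> g y = Some x.
Hypothesis f_incr : forall x y, f x = Some y -> h x < h y.

Let up x : {set X} := [set d | connect (edge f) d x].
Let down x : {set X} := [set d | connect (edge f) x d].

Let edgeE x y : edge f x y = (f x == Some y). Proof. by []. Qed.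

Lemma connect_incr x y : connect (edge f) x y -> h x <= h y.
Proof.
case/connectP => p; elim: p x => [|z p IH] x /= => [_ -> //|/andP[/eqP/f_incr xz pz] e].
exact: ltnW (leq_trans xz (IH _ pz e)).
Qed.

Lemma connect_headP x y : reflect
  (x = y \/ exists2 z, f x = Some z & connect (edge f) z y)
  (connect (edge f) x y).
Proof.
apply: (iffP idP) => [/connectP[[|z p] /=]|[->|[z xz zy]]]; first by left.
- move=> /andP[/eqP xz pz] e; right; exists z => //.
  by apply/connectP; exists p.
- exact: connect0.
- by apply: connect_trans zy; apply: connect1; rewrite edgeE xz.
Qed.

Lemma connect_lastP x y : reflect
  (x = y \/ exists2 z, connect (edge f) x z & f z = Some y)
  (connect (edge f) x y).
Proof.
apply: (iffP idP) => [/connectP[p]|[->|[z xz zy]]].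
- elim/last_ind: p => [|p z _]; first by left.
  rewrite rcons_path last_rcons => /andP[px /eqP e] ->.
  by right; exists (last x p) => //; apply/connectP; exists p.
- exact: connect0.
- by apply: (connect_trans xz); apply: connect1; rewrite edgeE zy.
Qed.

(** Since f has the partial inverse g and increases h, components are finite chains; the cardinality
    of [up x] is the position of x counted from the start, and that of [down x] its position from
    the end. *)
Lemma up_step x y : f x = Some y -> #|up y| = #|up x|.+1.
Proof.
move=> xy; have -> : up y = y |: up x.
  apply/setP => d; rewrite !inE; apply/connect_lastP/idP => [[->|[z dz zy]]|].
  - by rewrite eqxx.
  - by rewrite (_ : x = z) ?dz ?orbT //; apply: Some_inj; rewrite -(iffLR (fg _ _) xy); apply/fg.
  - by case/orP => [/eqP->|dx]; [left|right; exists x].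
rewrite cardsU1 inE; case: (boolP (connect _ _ _)) => // /connect_incr.
by have := f_incr xy; rewrite ltnNge => /negPf->.
Qed.

Lemma down_step x y : f x = Some y -> #|down x| = #|down y|.+1.
Proof.
move=> xy; have -> : down x = x |: down y.
  apply/setP => d; rewrite !inE; apply/connect_headP/idP => [[->|[z]]|].
  - by rewrite eqxx.
  - by rewrite xy => -[<-] ->; rewrite orbT.
  - by case/orP => [/eqP->|dx]; [left|right; exists y].
rewrite cardsU1 inE; case: (boolP (connect _ _ _)) => // /connect_incr.
by have := f_incr xy; rewrite ltnNge => /negPf->.
Qed.

Lemma up1 x : (#|up x| == 1) = (g x == None).
Proof.
case gx: (g x) => [z|]; last first.
  have -> : up x = [set x]; last by rewrite cards1.
  apply/setP => d; rewrite !inE; apply/connect_lastP/eqP => [[->//|[z _ /fg]]|->].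
    by rewrite gx.
  by left.
by move/fg: gx => /up_step->; rewrite eqSS cards_eq0; apply/set0Pn; exists z; rewrite inE connect0.
Qed.

Lemma down1 x : (#|down x| == 1) = (f x == None).
Proof.
case fx: (f x) => [z|]; last first.
  have -> : down x = [set x]; last by rewrite cards1.
  apply/setP => d; rewrite !inE; apply/connect_headP/eqP => [[->//|[z]]|->].
    by rewrite fx.
  by left.
by rewrite (down_step fx) eqSS cards_eq0; apply/set0Pn; exists z; rewrite inE connect0.
Qed.

Lemma up_gt0 x : 0 < #|up x|.
Proof. by apply/card_gt0P; exists x; rewrite inE connect0. Qed.

Lemma down_gt0 x : 0 < #|down x|.
Proof. by apply/card_gt0P; exists x; rewrite inE connect0. Qed.

Lemma string_ind (P : X -> Prop) x : P x ->
  (forall c d, f c = Some d -> (P c <-> P d)) ->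
  forall c, c \in crystal_string f x -> P c.
Proof.
move=> Px Pf c; rewrite inE => /connectP[p].
elim: p x Px => [|d p IH] x Px /= => [_ -> //|/andP[/orP[] /eqP xd pd] e].
  by apply: (IH d) => //; apply/(Pf _ _ xd).
by apply: (IH d) => //; apply/(Pf _ _ xd).
Qed.

Lemma mem_string0 x : x \in crystal_string f x.
Proof. by rewrite inE connect0. Qed.

Lemma string_total x c : c \in crystal_string f x ->
  connect (edge f) x c \/ connect (edge f) c x.
Proof.
move: c; apply: string_ind; first by left; apply: connect0.
move=> c d cd; split.
- case=> [xc|/connect_headP[<-|[z cz zx]]].
  + by left; apply: connect_trans xc _; apply: connect1; rewrite edgeE cd.
  + by left; apply: connect1; rewrite edgeE cd.
  + by right; move: cz; rewrite cd => -[->].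
- case=> [/connect_lastP[->|[z xz /fg zd]]|dx].
  + by right; apply: connect1; rewrite edgeE cd.
  + by left; move/fg: cd; rewrite zd => -[<-].
  + by right; apply: connect_trans dx; apply: connect1; rewrite edgeE cd.
Qed.

Lemma string_sum x c : c \in crystal_string f x ->
  #|up c| + #|down c| = #|up x| + #|down x|.
Proof.
move: c; apply: string_ind => // c d cd; rewrite (up_step cd) (down_step cd); lia.
Qed.

Lemma connect_up x y : connect (edge f) x y -> #|up x| = #|up y| -> x = y.
Proof.
case/connect_headP => // -[z xz zy] e.
have : #|up z| <= #|up y|.
  by apply: subset_leq_card; apply/subsetP => d; rewrite !inE => /connect_trans->.
by rewrite (up_step xz) e ltnn.
Qed.

Lemma string_inj x c : c \in crystal_string f x -> #|up c| = #|up x| -> c = x.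
Proof. by move=> /string_total[] xc e; [rewrite (connect_up xc)|rewrite (connect_up xc)]. Qed.

Lemma string_connect x c : connect (edge f) x c -> c \in crystal_string f x.
Proof.
rewrite inE; apply: connect_sub => y z yz.
by apply: connect1; rewrite yz.
Qed.

Lemma string_sym x c : c \in crystal_string f x -> crystal_string f c = crystal_string f x.
Proof.
rewrite inE => xc; apply/setP => d; rewrite !inE.
have sym : connect_sym (fun x y => edge f x y || edge f y x).
  by apply: sym_connect_sym => u v; rewrite orbC.
by apply/idP/idP; apply: connect_trans; rewrite // sym.
Qed.

Lemma string_up x k : k < #|up x| ->
  exists2 c, c \in crystal_string f x & #|up c| = #|up x| - k.
Proof.
elim: k => [|k IH] kx; first by exists x; rewrite ?mem_string0 ?subn0.
have [c cx uc] := IH (ltnW kx).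
have : #|up c| != 1 by lia.
rewrite up1; case gc: (g c) => [d|] // _; move/fg: gc => dc.
exists d; last by have := up_step dc; lia.
rewrite -(string_sym cx) inE; apply: connect1; rewrite /= !edgeE dc eqxx orbT //.
Qed.

Lemma string_down x k : k < #|down x| ->
  exists2 c, c \in crystal_string f x & #|up c| = #|up x| + k.
Proof.
elim: k => [|k IH] kx; first by exists x; rewrite ?mem_string0 ?addn0.
have [c cx uc] := IH (ltnW kx).
have : #|down c| != 1 by have := string_sum cx; lia.
rewrite down1; case fc: (f c) => [d|] // _.
exists d; last by have := up_step fc; lia.
by rewrite -(string_sym cx) inE; apply: connect1; rewrite /= !edgeE fc eqxx.
Qed.

Lemma string_reversalP x :
  string_reversal f x \in crystal_string f x /\
  #|up (string_reversal f x)| = #|down x|.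
Proof.
rewrite /string_reversal; case: pickP => [c /andP[cx /eqP]|none] //=.
have [c cx e] : exists2 c, c \in crystal_string f x & #|up c| = #|down x|.
  have ux := up_gt0 x; have dx := down_gt0 x.
  have [le|lt] := leqP (#|down x|) (#|up x|).
    have [|c cx uc] := @string_up x (#|up x| - #|down x|); first by lia.
    by exists c; rewrite // uc subKn.
  have [|c cx uc] := @string_down x (#|down x| - #|up x|); first by lia.
  by exists c; rewrite // uc subnKC // ltnW.
by have := none c; rewrite cx e eqxx.
Qed.

Lemma string_reversal_eq x y : y \in crystal_string f x -> #|up y| = #|down x| ->
  string_reversal f x = y.
Proof.
have [rx ur] := string_reversalP x => yx uy.
by apply: string_inj; [rewrite (string_sym yx)|rewrite ur].
Qed.

Lemma string_reversalK : involutive (string_reversal f).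
Proof.
move=> x; have [rx ur] := string_reversalP x.
apply: string_reversal_eq; first by rewrite (string_sym rx) mem_string0.
by have := string_sum rx; lia.
Qed.

Lemma string_reversal_top x y : g x = None -> f y = None ->
  connect (edge f) x y -> string_reversal f x = y.
Proof.
move=> gx fy xy; apply: string_reversal_eq; first exact: string_connect.
have := string_sum (string_connect xy).
move/eqP: gx; rewrite -up1 => /eqP->; move/eqP: fy; rewrite -down1 => /eqP->; lia.
Qed.

Lemma string_reversal_bot x : f x = None -> g (string_reversal f x) = None.
Proof.
move=> fx; apply/eqP; rewrite -up1; have [_ ->] := string_reversalP x.
by rewrite down1 fx.
Qed.

End Strings.

(** * Crystal operators on words and fillings *)

Definition abs : word -> seq nat := map absval.

(** The letter a is the last unmatched i of w, and after raising it is the first unmatched i + 1 of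
    w'. One relation thus describes both f_i and e_i. *)
Definition fstep (i : nat) (w w' : word) : Prop :=
  exists X a Y, [/\ w = X ++ a :: Y, w' = X ++ letter_succ a :: Y,
    absval a = i, depth i 0 (abs X) = 0 & unmatched i 0 (abs Y) = 0].

Lemma scan_cat i v w p O C : scan_unpaired i (v ++ w) p O C =
  let OC := scan_unpaired i v p O C in scan_unpaired i w (p + size v) OC.1 OC.2.
Proof.
elim: v p O C => [|x v IH] p O C /=; first by rewrite addn0.
case: ifP => _; first by rewrite IH addSnnS.
case: ifP => _; last by rewrite IH addSnnS.
by case: O => [|o O]; rewrite IH addSnnS.
Qed.

Lemma size_scan1 i w p O C :
  size (scan_unpaired i w p O C).1 = depth i (size O) (abs w).
Proof.
elim: w p O C => //= x w IH p O C; rewrite /has_absval.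
case: ifP => _; first by rewrite IH.
case: ifP => _; last by rewrite IH.
by case: O => [|o O]; rewrite IH.
Qed.

Lemma size_scan2 i w p O C :
  size (scan_unpaired i w p O C).2 = unmatched i (size O) (abs w) + size C.
Proof.
elim: w p O C => //= x w IH p O C; rewrite /has_absval.
case: ifP => _; first by rewrite IH.
case: ifP => _; last by rewrite IH.
by case: O => [|o O]; rewrite IH /= ?add0n // addnS.
Qed.

Lemma scan_balanced i w p O B C : unmatched i (size O) (abs w) = 0 ->
  exists O', scan_unpaired i w p (O ++ B) C = (O' ++ B, C).
Proof.
elim: w p O => [|x w IH] p O /=; first by exists O.
rewrite /has_absval; case: ifP => _; first by move=> h; apply: (IH p.+1 (p :: O)).
by case: ifP => _; [case: O => [|o O] //= |]; apply: IH.
Qed.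

(** Both stacks are decreasing: the last unmatched closing position is the head of one, the first
    unmatched opening position the last element of the other. *)
Lemma scan_splitE i X a Y :
  depth i 0 (abs X) = 0 -> unmatched i 0 (abs Y) = 0 ->
  (absval a = i -> exists C, (scan_unpaired i (X ++ a :: Y) 0 [::] [::]).2 = size X :: C) /\
  (absval a = i.+1 ->
    exists O, (scan_unpaired i (X ++ a :: Y) 0 [::] [::]).1 = rcons O (size X)).
Proof.
move=> dX uY; rewrite scan_cat /=.
have := size_scan1 i X 0 [::] [::]; rewrite dX.
case: (scan_unpaired _ X _ _ _) => [[|//] C] /= _.
split=> e; rewrite /has_absval e ?eqxx.
  have -> : (i == i.+1) = false by lia.
  have [O' ->] := @scan_balanced i Y (0 + size X).+1 [::] [::] (0 + size X :: C) uY.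
  by exists C.
have [O' ->] := @scan_balanced i Y (0 + size X).+1 [::] [:: size X] C uY.
by exists O'; rewrite cats1.
Qed.

Lemma set_letter_cat X a b Y : set_letter (X ++ a :: Y) (size X) b = X ++ b :: Y.
Proof. by rewrite /set_letter; elim: X => //= x X ->. Qed.

Lemma letter_at_cat X a Y : letter_at (X ++ a :: Y) (size X) = a.
Proof. by rewrite /letter_at nth_cat ltnn subnn. Qed.

Lemma fstep_word_f i w w' : fstep i w w' -> word_f i w = Some w'.
Proof.
move=> [X [a [Y [-> -> ai dX uY]]]].
have [/(_ ai)[C e] _] := @scan_splitE i X a Y dX uY.
rewrite /word_f /unpaired_close e.
have : size X = last 0 (rev (size X :: C)) by rewrite rev_cons last_rcons.
case: (rev _) (size_rev (size X :: C)) => //= p0 ps _ <-.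
by rewrite set_letter_cat letter_at_cat.
Qed.

Lemma fstep_word_e i w w' : fstep i w w' -> word_e i w' = Some w.
Proof.
move=> [X [a [Y [-> -> ai dX uY]]]].
have [_ h] := @scan_splitE i X (letter_succ a) Y dX uY.
have [|O e] := h; first by rewrite /absval /= -ai.
rewrite /word_e /unpaired_open e rev_rcons set_letter_cat letter_at_cat.
by case: a {h ai e}.
Qed.

Lemma unmatched_split i d w : 0 < unmatched i d (abs w) ->
  exists X a Y, [/\ w = X ++ a :: Y, absval a = i, depth i d (abs X) = 0
    & unmatched i 0 (abs Y) = 0].
Proof.
elim: w d => //= x w IH d.
have lift d' : 0 < unmatched i d' (abs w) ->
    (if absval x == i.+1 then d.+1 else if absval x == i then d.-1 else d) = d' ->
  exists X a Y, [/\ x :: w = X ++ a :: Y, absval a = i, depth i d (abs X) = 0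
    & unmatched i 0 (abs Y) = 0].
  move=> /IH[X [a [Y [-> ai dX uY]]]] e; exists (x :: X), a, Y; split=> //=.
  by rewrite e.
case: ifP => x1; first by move=> /lift; apply; rewrite x1.
case: ifP => x2; last by move=> /lift; apply; rewrite x1 x2.
case: (posnP (unmatched i d.-1 (abs w))) => [u0|h _]; last first.
  by apply: (lift _ h); rewrite x1 x2.
rewrite u0; case: (d =P 0) => // d0 _; exists [::], x, w; split=> //.
- exact/eqP.
- by move: u0; rewrite d0.
Qed.

Lemma depth_unmatched0 i d w : unmatched i 0 w = 0 -> depth i d w = d + depth i 0 w.
Proof.
move=> u0; have := depth_count i d w; have := depth_count i 0 w.
have := unmatched_mono i w (leq0n d); rewrite u0; lia.
Qed.

Lemma depth_split i w : 0 < depth i 0 (abs w) ->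
  exists X a Y, [/\ w = X ++ a :: Y, absval a = i.+1, depth i 0 (abs X) = 0
    & unmatched i 0 (abs Y) = 0].
Proof.
elim/last_ind: w => // w x IH; rewrite -cats1 /abs map_cat depth_cat /= -!/(abs _).
have ext : 0 < depth i 0 (abs w) ->
  (absval x = i -> 1 < depth i 0 (abs w)) ->
  exists X a Y, [/\ w ++ [:: x] = X ++ a :: Y, absval a = i.+1,
   depth i 0 (abs X) = 0 & unmatched i 0 (abs Y) = 0].
  move=> /IH[X [a [Y [-> ai dX uY]]]] xi; exists X, a, (Y ++ [:: x]).
  split=> //; first by rewrite -catA.
  rewrite /abs map_cat unmatched_cat -!/(abs _) uY /=.
  do 2 case: ifP => //; move=> /eqP/xi + _.
  by rewrite /abs map_cat depth_cat -!/(abs _) dX /= ai eqxx (depth_unmatched0 _ uY); lia.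
case: ifP => x1 => [_|].
  case: (posnP (depth i 0 (abs w))) => [d0|dp].
    by exists w, x, [::]; split=> //; apply/eqP.
  by apply: ext => // xi; move: x1; rewrite xi; lia.
by case: ifP => x2 h; apply: ext => //; move: h x2; lia.
Qed.

Lemma word_fP i w w' : word_f i w = Some w' <-> fstep i w w'.
Proof.
split; last exact: fstep_word_f.
case: (posnP (unmatched i 0 (abs w))) => [u0|/unmatched_split[X [a [Y [-> ai dX uY]]]]].
  rewrite /word_f /unpaired_close.
  by have /eqP := size_scan2 i w 0 [::] [::]; rewrite u0 => /nilP->.
have st : fstep i (X ++ a :: Y) (X ++ letter_succ a :: Y) by exists X, a, Y.
by rewrite (fstep_word_f st) => -[<-].
Qed.

Lemma word_eP i w w' : word_e i w' = Some w <-> fstep i w w'.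
Proof.
split; last exact: fstep_word_e.
case: (posnP (depth i 0 (abs w'))) => [d0|/depth_split[X [a [Y [-> ai dX uY]]]]].
  rewrite /word_e /unpaired_open.
  by have /eqP := size_scan1 i w' 0 [::] [::]; rewrite d0 => /nilP->.
have st : fstep i (X ++ letter_pred a :: Y) (X ++ a :: Y).
  exists X, (letter_pred a), Y; split=> //; last by rewrite /absval /= -/(absval a) ai.
  by case: a ai => a b /= ->.
by rewrite (fstep_word_e st) => -[<-].
Qed.

Lemma word_f_None i w : word_f i w = None <-> unmatched i 0 (abs w) = 0.
Proof.
split=> [|u0]; last first.
  rewrite /word_f /unpaired_close.
  by have /eqP := size_scan2 i w 0 [::] [::]; rewrite u0 => /nilP->.
case: (posnP (unmatched i 0 (abs w))) => // /unmatched_split[X [a [Y [-> ai dX uY]]]].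
by rewrite (@fstep_word_f i _ (X ++ letter_succ a :: Y)) //; exists X, a, Y.
Qed.

Lemma word_e_None i w : word_e i w = None <-> depth i 0 (abs w) = 0.
Proof.
split=> [|d0]; last first.
  rewrite /word_e /unpaired_open.
  by have /eqP := size_scan1 i w 0 [::] [::]; rewrite d0 => /nilP->.
case: (posnP (depth i 0 (abs w))) => // /depth_split[X [a [Y [-> ai dX uY]]]].
rewrite (@fstep_word_e i (X ++ letter_pred a :: Y)) //.
exists X, (letter_pred a), Y; split=> //; last by rewrite /absval /= -/(absval a) ai.
by case: a ai => a b /= ->.
Qed.

Lemma fstep_primed i w w' : fstep i w w' -> map primed w' = map primed w.
Proof. by move=> [X [a [Y [-> -> _ _ _]]]]; rewrite !map_cat. Qed.

Lemma fstep_abs i w w' : fstep i w w' -> exists X Y,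
  [/\ abs w = X ++ i :: Y, abs w' = X ++ i.+1 :: Y,
      depth i 0 X = 0 & unmatched i 0 Y = 0].
Proof.
move=> [X [a [Y [-> -> ai dX uY]]]]; exists (abs X), (abs Y).
by rewrite /abs !map_cat /= ai /letter_succ -/(absval a) ai.
Qed.

Lemma fstep_fmax i w w' : fstep i w w' -> fmax i 0 (abs w') = fmax i 0 (abs w).
Proof.
move=> /fstep_abs[X [Y [-> -> dX uY]]]; rewrite !fmax_cat dX /= !eqxx.
have -> : (i == i.+1) = false by lia.
rewrite (@fmax_id i 0 Y) ?(@fmax_id i 1 Y) //.
by apply/eqP; rewrite -leqn0 -uY unmatched_mono.
Qed.

Section Fillings.

Variables (n : nat) (la : seq nat).
Implicit Types (T U : filling n la) (w : word).

Definition rows T : seq word := [seq rev (trow T i) | i <- enum 'I_(size la)].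

Lemma size_trow T i : size (trow T i) = nth 0 la i.
Proof. by rewrite size_map size_enum_ord. Qed.

Lemma map_enum_ord_nth (A : Type) (x0 : A) (F : nat -> A) m :
  [seq F (val i) | i <- enum 'I_m] = mkseq F m.
Proof. by rewrite (map_comp F val) val_enum_ord. Qed.

Lemma shape_rows T : shape (rows T) = la.
Proof.
rewrite /shape /rows -map_comp.
rewrite (eq_map (g := fun i => nth 0 la (val i))); last first.
  by move=> i /=; rewrite size_rev size_trow.
by rewrite (map_enum_ord_nth 0 (nth 0 la)) mkseq_nth.
Qed.

Lemma size_rows T : size (rows T) = size la.
Proof. by rewrite -(size_map size) -/(shape _) shape_rows. Qed.

Lemma nth_rows T (i : 'I_(size la)) : nth [::] (rows T) i = rev (trow T i).
Proof.
rewrite /rows (nth_map i) ?size_enum_ord //.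
by rewrite nth_ord_enum.
Qed.

Lemma nth_trow T (i : 'I_(size la)) (j : 'I_(nth 0 la i)) :
  nth letter0 (trow T i) j = entry T (mkbox j).
Proof. by rewrite /trow (nth_map j) ?size_enum_ord // nth_ord_enum. Qed.

Lemma filling_eq T U : (forall i, trow T i = trow U i) -> T = U.
Proof.
move=> e; apply/ffunP => -[i j].
have := congr1 (fun r => nth letter0 r j) (e i).
rewrite !nth_trow /entry /mkbox /Tagged => -[].
by case: (T _) (U _) => [a b] [c d] /= /val_inj-> ->.
Qed.

Lemma revrow_inj : injective (@revrow n la).
Proof.
move=> T U e; apply: filling_eq => i; apply: (can_inj revK).
rewrite -!nth_rows; congr nth.
by apply: eq_from_flatten_shape; rewrite // !shape_rows.
Qed.

Definition fits w := (size w == sumn la) && all (fun x => absval x <= n) w.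

Lemma fits_revrow T : fits (revrow T).
Proof.
rewrite /fits size_flatten -/(rows T) shape_rows eqxx /=.
apply/allP => x /flatten_mapP[i _]; rewrite mem_rev => /mapP[j _ ->].
by rewrite /entry /absval /= -ltnS.
Qed.

Definition filling_of w : filling n la :=
  [ffun b : box la => let x := nth letter0 (rev (nth [::] (reshape la w) (tag b))) (tagged b) in
             (inord (absval x), primed x)].

Lemma revrow_filling_of w : fits w -> revrow (filling_of w) = w.
Proof.
case/andP=> /eqP sw /allP le_n.
have {2}-> : w = flatten (reshape la w) by rewrite reshapeKr // sw.
congr flatten; rewrite -/(rows _).
have sr : size (reshape la w) = size la.
  by rewrite -(size_map size) -/(shape _) reshapeKl // sw.
apply: (eq_from_nth (x0 := [::])); rewrite size_rows ?sr // => i ila.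
have rE := nth_rows (filling_of w) (Ordinal ila); rewrite /= in rE.
rewrite rE; apply: (can_inj revK); rewrite revK.
have szr : size (nth [::] (reshape la w) i) = nth 0 la i.
  by rewrite -(nth_map [::] 0 size) ?sr // -/(shape _) reshapeKl // sw.
apply: (eq_from_nth (x0 := letter0)); first by rewrite size_rev size_trow szr.
move=> j; rewrite size_trow => jla.
rewrite -[j]/(val (Ordinal jla)) nth_trow /entry /filling_of ffunE /=.
set x := nth letter0 _ _.
rewrite inordK; first by case: x.
rewrite ltnS; apply: le_n; rewrite -[w in _ \in w](@reshapeKr _ la) ?sw //.
apply/flattenP; exists (nth [::] (reshape la w) i); first by rewrite mem_nth ?sr.
by rewrite -mem_rev mem_nth // size_rev szr.
Qed.

Lemma tab_op_Some op T U : tab_op op T = Some U <-> op (revrow T) = Some (revrow U).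
Proof.
rewrite /tab_op; case: (op _) => [w|//]; case: pickP => [V /eqP<-|none].
  by split=> [[->]|[/revrow_inj->]].
by split=> // -[e]; have := none U; rewrite e eqxx.
Qed.

(** The search in [tab_op] could also fail because a letter exceeds n; [fits] excludes this, so that
    vanishing on tableaux means vanishing on words. *)
Lemma tab_op_None op T : (forall w, op (revrow T) = Some w -> fits w) ->
  tab_op op T = None <-> op (revrow T) = None.
Proof.
rewrite /tab_op; case: (op _) => [w|//] /(_ w erefl) fw.
by case: pickP => [//|/(_ (filling_of w))]; rewrite revrow_filling_of ?eqxx.
Qed.

Lemma fits_fstep_f i w w' : i < n -> fstep i w w' -> fits w -> fits w'.
Proof.
move=> i_n [X [a [Y [-> -> ai _ _]]]].
rewrite /fits !size_cat !all_cat /= => /andP[-> /and3P[-> _ ->]].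
by rewrite andbT /absval /= -/(absval a) ai.
Qed.

Lemma fits_fstep_e i w w' : fstep i w w' -> fits w' -> fits w.
Proof.
move=> [X [a [Y [-> -> ai _ _]]]].
rewrite /fits !size_cat !all_cat /= => /andP[-> /and3P[-> h ->]].
by rewrite andbT; exact: ltnW h.
Qed.

Definition tabw T := abs (revrow T).
Definition tabp T := map primed (revrow T).

Lemma tabw_inj T U : tabw T = tabw U -> tabp T = tabp U -> T = U.
Proof.
move=> e1 e2; apply: revrow_inj; have := erefl (zip (tabw T) (tabp T)).
rewrite {2}e1 {2}e2 /tabw /tabp.
by rewrite -[abs _]/(unzip1 _) -[map primed _]/(unzip2 _) -[abs _]/(unzip1 _)
  -[map primed _]/(unzip2 _) !zip_unzip.
Qed.

Lemma tab_fP i T U : tab_f i T = Some U <-> fstep i (revrow T) (revrow U).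
Proof. by split=> [/tab_op_Some/word_fP|/word_fP/tab_op_Some]. Qed.

Lemma tab_eP i T U : tab_e i U = Some T <-> fstep i (revrow T) (revrow U).
Proof. by split=> [/tab_op_Some/word_eP|/word_eP/tab_op_Some]. Qed.

Lemma tab_f_None i T : i < n -> tab_f i T = None <-> unmatched i 0 (tabw T) = 0.
Proof.
move=> i_n; rewrite -word_f_None; apply: tab_op_None => w /word_fP st.
exact: fits_fstep_f st (fits_revrow T).
Qed.

Lemma tab_e_None i T : tab_e i T = None <-> depth i 0 (tabw T) = 0.
Proof.
rewrite -word_e_None; apply: tab_op_None => w /word_eP st.
exact: fits_fstep_e st (fits_revrow T).
Qed.

Lemma tab_fe i T U : tab_f i T = Some U <-> tab_e i U = Some T.
Proof. by split=> [/tab_fP/tab_eP|/tab_eP/tab_fP]. Qed.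

Lemma tab_f_incr i T U : tab_f i T = Some U -> cnt i.+1 (tabw T) < cnt i.+1 (tabw U).
Proof.
move=> /tab_fP/fstep_abs[X [Y [e1 e2 _ _]]]; rewrite /tabw e1 e2 !cnt_cat !cnt_cons eqxx.
have -> : (i == i.+1) = false by lia.
lia.
Qed.

Lemma sigmaK i : involutive (@sigma n la i).
Proof. exact: string_reversalK (@tab_fe i) (@tab_f_incr i). Qed.

Lemma sigma_bot i T : i < n -> unmatched i 0 (tabw T) = 0 ->
  depth i 0 (tabw (sigma i T)) = 0.
Proof.
move=> i_n /(tab_f_None _ i_n) fN; apply/tab_e_None.
exact: string_reversal_bot (@tab_fe i) (@tab_f_incr i) _ fN.
Qed.

Lemma sigma_ind i (P : filling n la -> Prop) T : P T ->
  (forall U V, tab_f i U = Some V -> (P U <-> P V)) -> P (sigma i T).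
Proof.
move=> PT Pf; have [sT _] := string_reversalP (@tab_fe i) (@tab_f_incr i) T.
exact: string_ind PT Pf _ sT.
Qed.

Lemma tabp_sigma i T : tabp (sigma i T) = tabp T.
Proof.
by apply: (@sigma_ind i (fun U => tabp U = tabp T)) => // U V /tab_fP/fstep_primed;
  rewrite /tabp => ->.
Qed.

Lemma connect_fmax i T : i < n -> exists U,
  [/\ connect (edge (@tab_f n la i)) T U, tab_f i U = None
    & tabw U = fmax i 0 (tabw T)].
Proof.
move=> i_n; move: {2}(cnt i (tabw T)) (leqnn (cnt i (tabw T))) => m.
elim: m T => [|m IH] T leT.
  have u0 : unmatched i 0 (tabw T) = 0.
    case: (posnP (unmatched i 0 (tabw T))) leT => // /unmatched_split[X [a [Y [e ai _ _]]]].
    rewrite /tabw e /abs map_cat /= cnt_cat cnt_cons ai eqxx; lia.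
  by exists T; split; [exact: connect0|apply/tab_f_None|rewrite fmax_id].
case fT: (tab_f i T) => [V|]; last first.
  by exists T; split=> //; rewrite fmax_id //; apply/tab_f_None.
have st := fT; move/tab_fP in st.
have [|U [VU fU eU]] := IH V.
  have [X [Y [e1 e2 _ _]]] := fstep_abs st.
  move: leT; rewrite /tabw e1 e2 !cnt_cat !cnt_cons eqxx.
  have -> : (i.+1 == i) = false by lia.
  lia.
exists U; split=> //; last by rewrite eU /tabw (fstep_fmax st).
by apply: connect_trans VU; apply: connect1; rewrite /edge fT.
Qed.

(** For an element inside its string the word after reversal is not F_i of the word; the depth
    hypothesis places T at the top. *)
Lemma tabw_sigma i T : i < n -> depth i 0 (tabw T) = 0 ->
  tabw (sigma i T) = fmax i 0 (tabw T).
Proof.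
move=> i_n /tab_e_None eN; have [U [TU fU <-]] := connect_fmax T i_n.
by rewrite /sigma (string_reversal_top (@tab_fe i) (@tab_f_incr i) eN fU TU).
Qed.

Lemma sigmas_inj s : injective (@sigmas n la s).
Proof.
by elim: s => //= i s IH T U /(can_inj (@sigmaK i))/IH.
Qed.

Lemma tabp_sigmas s T : tabp (sigmas s T) = tabp T.
Proof. by elim: s => //= i s IH; rewrite tabp_sigma. Qed.

Lemma tabw_sigmas s T : all (fun i => i < n) s -> valid s (tabw T) ->
  tabw (sigmas s T) = fmaxs s (tabw T).
Proof.
elim: s => //= i s IH /andP[i_n s_n] /andP[v /eqP d0].
by rewrite tabw_sigma ?IH.
Qed.

End Fillings.

(** * Bottom ends of strings, and when the operators vanish *)

Lemma strict_unmatched i d w : strict_at i d w -> unmatched i d w = 0.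
Proof.
elim: w d => //= x w IH d.
case: (x =P i.+1) => _; first exact: IH.
case: (x =P i) => _; last exact: IH.
by case/andP=> d1 /IH->; have -> : (d == 0) = false by lia.
Qed.

Lemma strict_at_fmax_next i k d d' e w : i.+1 = k -> d <= d' ->
  strict_at i d (fmax k e w) -> strict_at i d' w.
Proof.
move=> <-.
have F1 : (i.+2 == i.+1) = false by lia.
have F2 : (i.+2 == i) = false by lia.
elim: w d d' e => //= x w IH d d' e le.
case: (x =P i.+2) => [->|n1].
  by rewrite /= ?(F1, F2); apply: IH.
case: (x =P i.+1) => [->|n2] /=.
  by case: (e == 0); rewrite ?(F1, F2, eqxx); apply: IH; lia.
rewrite (introF eqP n2); case: (x =P i) => _; last exact: IH.
by case/andP=> h /IH->; lia.
Qed.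

(** The first i is unmatched, hence raised, and no i + 1 precedes it. *)
Lemma index_fmax_low i y : starts_low i y -> index i.+1 (fmax i 0 y) = index i y.
Proof.
elim: y => //= x y IH /andP[n1]; rewrite (negPf n1).
case: (x =P i) => [_|n2] /=; first by rewrite eqxx.
by move=> /IH->; rewrite (negPf n1).
Qed.

Lemma word_e1barE w : word_e1bar w = None <-> starts_low 1 (abs w).
Proof.
have -> : starts_low 1 (abs w) =
    ~~ has (has_absval 2) w || (find (has_absval 1) w < find (has_absval 2) w).
  elim: w => //= x w ->; rewrite /has_absval.
  case: (absval x =P 2) => [e2|n2] /=; first by case: ifP.
  by case: (absval x =P 1) => [e1|n1] //=; rewrite orbT.
by rewrite /word_e1bar; case: ifP => // _; split=> //; case: ifP.
Qed.

Definition blocked (b : bool) (w : word) :=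
  ((1, b) \notin w) || ((1, ~~ b) \in take (index (1, b) w) w).

Lemma blockedE b w : blocked b w =
  ((1 \in abs w) ==> (nth false (map primed w) (index 1 (abs w)) == ~~ b)).
Proof.
rewrite /blocked; elim: w => [|[a c] w IH] //.
rewrite /= !inE /absval /primed /= -/absval -/primed.
have [->|a1] := eqVneq a 1.
  rewrite !xpair_eqE !eqxx /=; case: b c {IH} => [] [] //=; rewrite ?orbT //.
rewrite !xpair_eqE ![1 == a]eq_sym (negPf a1) /=.
rewrite in_cons xpair_eqE [1 == a]eq_sym (negPf a1) /=; exact: IH.
Qed.

Lemma word_e0E w : word_e0 w = None <-> blocked true w.
Proof. by rewrite /word_e0 -/(blocked true w); case: blocked. Qed.

Lemma word_f0E w : word_f0 w = None <-> blocked false w.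
Proof. by rewrite /word_f0 -/(blocked false w); case: blocked. Qed.

Lemma fits_set_letter n la w p x : fits n la w -> p < size w -> absval x <= n ->
  fits n la (set_letter w p x).
Proof.
case/andP=> /eqP sw aw pw xn; rewrite /fits size_set_nth (maxn_idPr pw) sw eqxx /=.
apply/(all_nthP letter0) => q; rewrite size_set_nth (maxn_idPr pw) => qw.
by rewrite nth_set_nth /=; case: ifP => // _; apply: (all_nthP letter0 aw).
Qed.

Lemma fits_letter_at n la w p : fits n la w -> absval (letter_at w p) <= n.
Proof.
case/andP=> _ /allP h; have [pw|pw] := ltnP p (size w).
  by apply: h; rewrite mem_nth.
by rewrite /letter_at nth_default.
Qed.

Section Operators.

Variables (n : nat) (la : seq nat).
Hypothesis n_gt0 : 0 < n.
Implicit Types (T U : filling n la).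

Lemma tab_e1bar_None T : tab_e1bar T = None <-> starts_low 1 (tabw T).
Proof.
rewrite -word_e1barE; apply: tab_op_None => w.
have fT := fits_revrow T; rewrite /word_e1bar.
case: ifP => // /norP[/negPn h2 le21].
have j2 := h2; rewrite has_find in j2.
have h (x : letter) : absval x <= n -> absval (letter_pred x) <= n by case: x => a b /=;
  rewrite /absval /=; lia.
case: ifP => [_|/negbFE h1] [<-]; first by apply: fits_set_letter => //; apply: h;
  exact: fits_letter_at fT.
have k1 := h1; rewrite has_find in k1.
apply: fits_set_letter; first by apply: fits_set_letter => //; exact: fits_letter_at fT.
  by rewrite size_set_nth (maxn_idPr j2).
by apply: h; exact: fits_letter_at fT.
Qed.

Lemma tab_e0_None T : tab_e0 T = None <-> blocked true (revrow T).
Proof.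
rewrite -word_e0E; apply: tab_op_None => w; rewrite /word_e0.
case: ifP => // /norP[/negPn h _] [<-].
by rewrite fits_set_letter ?fits_revrow ?index_mem.
Qed.

Lemma tab_f0_None T : tab_f0 T = None <-> blocked false (revrow T).
Proof.
rewrite -word_f0E; apply: tab_op_None => w; rewrite /word_f0.
case: ifP => // /norP[/negPn h _] [<-].
by rewrite fits_set_letter ?fits_revrow ?index_mem.
Qed.

Lemma conj_op_None s t op T : conj_op (n := n) (la := la) s op t T = None <->
  op (sigmas t T) = None.
Proof. by rewrite /conj_op; case: (op _). Qed.

Lemma highest_wordP T :
  (forall i, 1 <= i <= n.-1 -> tab_e i T = None) <-> highest_word n.-1 (tabw T).
Proof. by split=> h i ilen; apply/tab_e_None/h. Qed.

Lemma tab_ebar_None i T : highest_word n.-1 (tabw T) -> 1 <= i <= n.-1 ->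
  tab_ebar i T = None <-> starts_low 1 (fmaxs (zigzag 1 i.-1) (tabw T)).
Proof.
move=> hT ilen; rewrite conj_op_None tab_e1bar_None -/(zigzag 1 i.-1) tabw_sigmas //.
  by apply/allP => j /flatten_mapP[l]; rewrite mem_iota !inE => ? /orP[]/eqP->; lia.
by have [| v _] := @valid_zigzag 1 i.-1 n.-1 (tabw T) isT _ hT; first by lia.
Qed.

Lemma sigma_w0E : @sigma_w0 n la = sigmas (w0word 0 n.-1).
Proof. by rewrite /sigma_w0 /w0word subn0. Qed.

Lemma sigma_w0_inj : injective (@sigma_w0 n la).
Proof. by rewrite sigma_w0E; apply: sigmas_inj. Qed.

Lemma tabp_sigma_w0 T : tabp (sigma_w0 T) = tabp T.
Proof. exact: tabp_sigmas. Qed.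

Lemma tabw_sigma_w0 T : highest_word n.-1 (tabw T) ->
  tabw (sigma_w0 T) = fmaxs (w0word 0 n.-1) (tabw T).
Proof.
move=> hT; rewrite sigma_w0E tabw_sigmas //.
  by apply/allP => i /mem_w0word; lia.
by have [] := valid_w0word (leq0n _) hT.
Qed.

Lemma sigma_w0_strict T j : highest_word n.-1 (tabw T) ->
  (forall i, 1 <= i <= n.-1 -> tab_ebar i T = None) -> 0 < j <= n.-1 ->
  strict_at j 0 (tabw (sigma_w0 T)).
Proof.
move=> hT ebar jn; rewrite tabw_sigma_w0 //.
apply: (strict_w0word hT) => // k kn.
by apply/(@tab_ebar_None k.+1) => //; apply: ebar.
Qed.

(** F_w0 fixes the word of T, and climbing from T by operators e_i does not change F_w0. At the top
    S of the climb F_w0 is realized by sigma_w0, so sigma_w0 S has the word and the primes of T. *)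
Lemma lowest_lift T : (forall i, 1 <= i <= n.-1 -> tab_f i T = None) ->
  exists2 S, highest_word n.-1 (tabw S) & sigma_w0 S = T.
Proof.
move=> lowT.
have TE : fmaxs (w0word 0 n.-1) (tabw T) = tabw T.
  have : all (fun i => unmatched i 0 (tabw T) == 0) (w0word 0 n.-1).
    apply/allP => i /mem_w0word iw; apply/eqP/tab_f_None; [lia|exact: lowT].
  by elim: (w0word _ _) => //= i s IH /andP[/eqP u0 /IH->]; rewrite fmax_id.
suff [S [hS wS pS]] : exists S : filling n la, [/\ highest_word n.-1 (tabw S),
    fmaxs (w0word 0 n.-1) (tabw S) = tabw T & tabp S = tabp T].
  by exists S => //; apply: tabw_inj; rewrite ?tabp_sigma_w0 ?tabw_sigma_w0.
(* Termination of the climb: each e_i lowers the sum of the letters by one. *)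
suff gen m U : sumn (tabw U) <= m -> fmaxs (w0word 0 n.-1) (tabw U) = tabw T ->
    tabp U = tabp T -> exists S : filling n la, [/\ highest_word n.-1 (tabw S),
    fmaxs (w0word 0 n.-1) (tabw S) = tabw T & tabp S = tabp T].
  exact: (gen _ T (leqnn _)).
elim: m U => [|m IH] U leU wU pU;
  case: (altP (@allP _ (fun i => tab_e i U == None) (iota 1 n.-1))) => hU;
  try by exists U; split=> //; apply/highest_wordP => i hi; apply/eqP/hU;
         rewrite mem_iota; lia.
all: case/allPn: hU => i; rewrite mem_iota; case eU: (tab_e i U) => [V|//] hi _.
all: have st := eU; move/tab_eP in st; have [X [Y [e1 e2 _ _]]] := fstep_abs st.
all: have sUV : sumn (tabw U) = (sumn (tabw V)).+1
  by rewrite /tabw e1 e2 !sumn_cat /=; lia.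
  by lia.
apply: (IH V); first by lia.
  rewrite -(@fmaxs_w0word_r _ i) -?(fstep_fmax st); last by lia.
  by rewrite fmaxs_w0word_r //; lia.
by rewrite -pU /tabp (fstep_primed st).
Qed.

Lemma tab_fbar'_None i T S : sigma_w0 S = T ->
  tab_fbar' i T = None <-> tab_ebar (n - i) S = None.
Proof.
move=> <-; rewrite /tab_fbar' finv_f; last exact: sigma_w0_inj.
by case: (tab_ebar _ _).
Qed.

(** Strictness at j puts U at the bottom of its j-string, so sigma_j leads to the top, a word y with
    F_j y the word of U. Strictness also forces j to come first in y, so the first j of y sits where
    U has its first j + 1. Strictness at smaller indices is pulled back for the next step. *)
Lemma tabw_sigma_desc i T : 0 < i <= n ->
  (forall j, 0 < j <= n.-1 -> strict_at j 0 (tabw T)) ->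
  index 1 (tabw (sigmas (iota 1 i.-1) T)) = index i (tabw T).
Proof.
move=> hi sT.
suff gen k j : 0 < j -> j + k = i ->
    (forall l, 0 < l < j -> strict_at l 0 (tabw (sigmas (iota j k) T))) /\
    index j (tabw (sigmas (iota j k) T)) = index i (tabw T).
  by have [//||_ ->] := gen i.-1 1; lia.
elim: k j => [|k IH] j j0 jk.
  have -> : j = i by lia.
  by split=> // l hl; apply: sT; lia.
have [||str <-] := IH j.+1; [by []|by lia|].
set U := sigmas (iota j.+1 k) T in str *.
have -> : sigmas (iota j k.+1) T = sigma j U by [].
have sj : strict_at j 0 (tabw U) by apply: str; lia.
have jn : j < n by lia.
have d0 := sigma_bot jn (strict_unmatched sj).
have UE : tabw U = fmax j 0 (tabw (sigma j U)) by rewrite -tabw_sigma // sigmaK.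
have low : starts_low j (tabw (sigma j U)).
  by apply: strict_starts_low; rewrite // -UE.
rewrite UE index_fmax_low //; split=> // l hl.
have sl : strict_at l 0 (tabw U) by apply: str; lia.
rewrite UE in sl; have [e|ne] := eqVneq l.+1 j.
  exact: strict_at_fmax_next e _ sl.
by move: sl; rewrite strict_at_fmax_far //; lia.
Qed.

Lemma tab_f0_at_None i T : 0 < i <= n ->
  (forall j, 0 < j <= n.-1 -> strict_at j 0 (tabw T)) ->
  tab_f0_at i T = None <->
  (i \in tabw T -> nth false (tabp T) (index i (tabw T))).
Proof.
move=> hi sT; rewrite conj_op_None tab_f0_None blockedE -/(tabw _) -/(tabp _).
rewrite tabp_sigmas tabw_sigma_desc // -!index_mem tabw_sigma_desc //.
have -> : size (tabw (sigmas (iota 1 i.-1) T)) = size (tabw T).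
  by have := congr1 size (tabp_sigmas (iota 1 i.-1) T); rewrite /tabp /tabw /abs !size_map.
by split=> [/implyP h /h/eqP|h]; [|apply/implyP => /h ->].
Qed.

End Operators.

(** * Preservation of decomposition tableaux *)

(* The effect of f_i on a contiguous factor of a word. *)
Inductive wstep (i : nat) (G : seq nat) : seq nat -> Prop :=
| WStay : wstep i G G
| WMove X Y of G = X ++ i :: Y & depth i 0 X = 0 & unmatched i 0 Y = 0 :
    wstep i G (X ++ i.+1 :: Y).

Lemma wstep_size i G G' : wstep i G G' -> size G' = size G.
Proof. by case=> // X Y -> _ _; rewrite !size_cat. Qed.

Lemma wstep_take i k G G' : wstep i G G' -> wstep i (take k G) (take k G').
Proof.
case=> [|X Y -> dX uY]; first exact: WStay.
rewrite !take_cat; case: ltnP => kX; first exact: WStay.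
case: (k - size X) => [|d] /=; first by rewrite cats0; apply: WStay.
apply: WMove => //; move: uY; rewrite -{1}(cat_take_drop d Y) unmatched_cat; lia.
Qed.

Lemma wstep_drop i k G G' : wstep i G G' -> wstep i (drop k G) (drop k G').
Proof.
case=> [|X Y -> dX uY]; first exact: WStay.
rewrite !drop_cat; case: ltnP => kX; last first.
  by case: (k - size X) => [|d] /=; [apply: (@WMove _ _ [::])|apply: WStay].
apply: WMove => //; move: dX; rewrite -{1}(cat_take_drop k X) depth_cat.
have := @depth_mono i 0 (depth i 0 (take k X)) (drop k X) isT; lia.
Qed.

Lemma subseq_cat_split (T : eqType) (s1 s2 G : seq T) : subseq (s1 ++ s2) G ->
  exists G1 G2, [/\ G = G1 ++ G2, subseq s1 G1 & subseq s2 G2].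
Proof.
elim: G s1 => [|x G IH] s1.
  by case: s1 => //; exists [::], [::].
case: s1 => [|y s1] /=; first by exists [::], (x :: G).
case: eqP => [->|xy] h.
  have [G1 [G2 [-> h1 h2]]] := IH _ h.
  by exists (x :: G1), G2; split=> //=; rewrite eqxx.
have [G1 [G2 [-> h1 h2]]] := IH (y :: s1) h.
by exists (x :: G1), G2; split=> //=; rewrite (introF eqP xy).
Qed.

Lemma subseq_mid (T : eqType) (s X Y : seq T) a : subseq s (X ++ a :: Y) ->
  subseq s (X ++ Y) \/
  exists s1 s3, [/\ s = s1 ++ a :: s3, subseq s1 X & subseq s3 Y].
Proof.
elim: X s => [|x X IH] [|y s] /=; try by (left; rewrite ?sub0seq).
  by case: (y =P a) => [->|_]; [right; exists [::], s|left].
case: (y =P x) => [->|_]; case/IH=> [|[s1 [s3 [-> h1 h3]]]]; try by left.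
  by right; exists (x :: s1), s3; split=> //=; rewrite eqxx.
right; exists s1, s3; split=> //.
exact: subseq_trans h1 (subseq_cons X x).
Qed.

Lemma subseq_mid_sub (T : eqType) (s X Y : seq T) a :
  subseq s (X ++ Y) -> subseq s (X ++ a :: Y).
Proof.
by move=> h; apply: subseq_trans h _; apply: cat_subseq => //; apply: subseq_cons.
Qed.

Lemma gtn_catE s a t : sorted gtn (s ++ a :: t) =
  [&& sorted gtn s, all (fun x => a < x) s, all (fun x => x < a) t & sorted gtn t].
Proof.
have tr : transitive gtn by move=> x y z /= h1 h2; apply: ltn_trans h2 h1.
rewrite !(sorted_pairwise tr) pairwise_cat /= allrel_consr.
apply/idP/idP; first by case/and3P=> /andP[-> _] -> /andP[-> ->].
case/and4P=> -> h2 h3 ->; rewrite h2 h3 !andbT /=.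
apply/allrelP => x y xs yt; apply: ltn_trans (allP h3 _ yt) (allP h2 _ xs).
Qed.

Lemma leq_catE s a t : sorted leq (s ++ a :: t) =
  [&& sorted leq s, all (fun x => x <= a) s, all (fun x => a <= x) t & sorted leq t].
Proof.
rewrite !(sorted_pairwise leq_trans) pairwise_cat /= allrel_consr.
apply/idP/idP; first by case/and3P=> /andP[-> _] -> /andP[-> ->].
case/and4P=> -> h2 h3 ->; rewrite h2 h3 !andbT /=.
apply/allrelP => x y xs yt; apply: leq_trans (allP h2 _ xs) (allP h3 _ yt).
Qed.

Definition has_sub (R : rel nat) k G :=
  exists s, [/\ subseq s G, sorted R s & size s = k].

Lemma depth0_suffix i X1 X2 : depth i 0 (X1 ++ X2) = 0 -> cnt i.+1 X2 <= cnt i X2.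
Proof.
rewrite depth_cat => h; have := @depth_mono i 0 (depth i 0 X1) X2 isT.
have := depth_count i 0 X2; lia.
Qed.

Lemma unmatched0_prefix i Y1 Y2 : unmatched i 0 (Y1 ++ Y2) = 0 -> cnt i Y1 <= cnt i.+1 Y1.
Proof.
rewrite unmatched_cat => h; have := depth_count i 0 Y1; lia.
Qed.

Lemma subseq_nseq_cnt k i (G : seq nat) : k <= cnt i G -> subseq (nseq k i) G.
Proof.
elim: G k => [|x G IH] k; first by rewrite cnt_nil; case: k.
case: k => [|k]; first by rewrite sub0seq.
rewrite cnt_cons /=; case: (i =P x) => [ix|ne] h.
  by apply: IH; move: h; rewrite -ix eqxx; lia.
by apply: (IH k.+1); move: h; have -> : (x == i) = false by lia.
Qed.

(** A decreasing subword through the changed letter usually changes along with it; this fails only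
    if it contains both i and i + 1, and then the bracketing offers another place for one of
    them. *)
Lemma has_sub_dec i k G G' : wstep i G G' -> has_sub gtn k G <-> has_sub gtn k G'.
Proof.
case=> // X Y -> dX uY; split=> -[s [sub srt sz]].
  case/subseq_mid: sub => [|[s1 [s3 [e sub1 sub3]]]].
    by exists s; split=> //; apply: subseq_mid_sub.
  move: srt; rewrite e gtn_catE => /and4P[srt1 a1 a3 srt3].
  case: (boolP (i.+1 \in s1)) => [i1|i1]; last first.
    exists (s1 ++ i.+1 :: s3); split.
    - by rewrite cat_subseq //= eqxx.
    - rewrite gtn_catE srt1 srt3 /= andbT; apply/andP; split.
        apply/allP => x xs; have := allP a1 x xs; rewrite leq_eqVlt.
        by case: eqP => // xE; rewrite xE xs in i1.
      by apply/allP => x /(allP a3) /ltnW.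
    - by rewrite -sz e !size_cat.
  (* Here i + 1 is the last letter of [s1], taken from X. No bracket of X stays open, so an i
     follows that i + 1 inside X and replaces the changed letter. *)
  exists s; split=> //; last by rewrite e gtn_catE srt1 a1 a3.
  case/splitPr: i1 (sub1) srt1 a1 e => p q sub1' srt1 a1 e.
  have qE : q = [::].
    move: srt1; rewrite gtn_catE => /and4P[_ _ aq _].
    case: q aq {sub1'} a1 e => //= x q /andP[xi _]; rewrite all_cat /= => /and4P[_ _ ix _]; lia.
  subst q; have [X1 [X2 [XE s0 sX2]]] := subseq_cat_split sub1'.
  rewrite e -catA XE -catA cat_subseq //=.
  rewrite sub1seq in sX2; case/splitPr: sX2 XE => P Q XE.
  rewrite -catA /= -[_ :: i :: s3]/([::] ++ [:: i.+1] ++ i :: s3).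
  apply: cat_subseq (sub0seq _) _; rewrite /= eqxx.
  have : i \in Q.
    have := @depth0_suffix i (X1 ++ P) (i.+1 :: Q); rewrite -catA /= -XE => /(_ dX).
    rewrite !cnt_cons eqxx -cnt_gt0; have -> : (i.+1 == i) = false by lia.
    lia.
  case/splitPr => Q1 Q2; rewrite -catA; apply: subseq_trans (suffix_subseq _ _).
  rewrite /= eqxx; apply: subseq_trans sub3 _.
  by rewrite -cat_rcons; apply: suffix_subseq.
case/subseq_mid: sub => [|[s1 [s3 [e sub1 sub3]]]].
  by exists s; split=> //; apply: subseq_mid_sub.
move: srt; rewrite e gtn_catE => /and4P[srt1 a1 a3 srt3].
case: (boolP (i \in s3)) => [i3|i3]; last first.
  exists (s1 ++ i :: s3); split.
  - by rewrite cat_subseq //= eqxx.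
  - rewrite gtn_catE srt1 srt3 /= andbT; apply/andP; split.
      by apply/allP => x /(allP a1) /ltnW.
    apply/allP => x xs; have := allP a3 x xs; rewrite ltnS leq_eqVlt.
    by case: eqP => // xE; rewrite -xE xs in i3.
  - by rewrite -sz e !size_cat.
(* Symmetric case: [s3] begins with an i of Y. That i is matched inside Y, so an earlier i + 1 of Y
   replaces the changed letter. *)
exists s; split=> //; last by rewrite e gtn_catE srt1 a1 a3.
case/splitPr: i3 (sub3) srt3 a3 e => p q sub3' srt3 a3 e.
have pE : p = [::].
  move: srt3; rewrite gtn_catE => /and4P[_ ap _ _].
  case: p ap {sub3'} a3 e => //= x p /andP[xi _] /andP[ix _]; lia.
subst p; rewrite e cat_subseq //=.
have -> : (i.+1 == i) = false by lia.
have [Y1 [Y2 [YE sY1 sY2]]] := @subseq_cat_split _ [:: i] q Y sub3'.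
rewrite sub1seq in sY1; case/splitPr: sY1 YE => P Q YE.
rewrite YE -catA /=.
have : i.+1 \in P.
  have := @unmatched0_prefix i (P ++ [:: i]) (Q ++ Y2); rewrite -catA /=.
  have <- : Y = P ++ i :: Q ++ Y2 by rewrite YE -catA.
  move=> /(_ uY); rewrite !cnt_cat !cnt_cons !cnt_nil eqxx -cnt_gt0.
  have -> : (i == i.+1) = false by lia.
  lia.
case/splitPr => P1 P2; rewrite -catA; apply: subseq_trans (suffix_subseq _ _).
rewrite /= eqxx; apply: subseq_trans (suffix_subseq _ _).
by rewrite /= eqxx; apply: subseq_trans sY2 _; apply: suffix_subseq.
Qed.

Lemma sorted_leq_split_l s a : sorted leq s -> all (fun x => x <= a.+1) s ->
  exists k t, s = t ++ nseq k a.+1 /\ all (fun x => x <= a) t.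
Proof.
elim: s => [|x s IH]; first by exists 0, [::].
rewrite /= (path_sortedE leq_trans) => /andP[xs srt] /andP[xa /(IH srt)[k [t [e ta]]]].
have [xa'|xa'] := leqP x a; first by exists k, (x :: t); rewrite e /= xa' ta.
have xE : x = a.+1 by lia.
exists k.+1, [::]; split=> //=; rewrite xE e; congr (_ :: _).
case: t ta e => // y t /= /andP[ya _] e; move: xs; rewrite e /= => /andP[]; lia.
Qed.

Lemma sorted_leq_split_r s a : sorted leq s -> all (fun x => a <= x) s ->
  exists k t, s = nseq k a ++ t /\ all (fun x => a < x) t.
Proof.
elim: s => [|x s IH]; first by exists 0, [::].
rewrite /= (path_sortedE leq_trans) => /andP[xs srt] /andP[xa /(IH srt)[k [t [e ta]]]].
have [xa'|xa'] := leqP x a; first by have -> : x = a; [lia|exists k.+1, t; rewrite e].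
exists 0, (x :: s); split=> //=; rewrite xa' /=.
by apply/allP => y /(allP xs); lia.
Qed.

(** After the changed letter the subword may use c further letters i from a prefix of Y. That prefix
    has at least as many letters i + 1, so the whole plateau can be raised; the converse lowers a
    plateau in a suffix of X. *)
Lemma has_sub_inc i k G G' : wstep i G G' -> has_sub leq k G <-> has_sub leq k G'.
Proof.
case=> // X Y -> dX uY; split=> -[s [sub srt sz]].
  case/subseq_mid: sub => [|[s1 [s3 [e sub1 sub3]]]].
    by exists s; split=> //; apply: subseq_mid_sub.
  move: srt; rewrite e leq_catE => /and4P[srt1 a1 a3 srt3].
  have [c [t [e3 ta]]] := sorted_leq_split_r srt3 a3.
  rewrite e3 in sub3 srt3 a3.
  have [Y1 [Y2 [YE sY1 sY2]]] := subseq_cat_split sub3.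
  exists (s1 ++ i.+1 :: nseq c i.+1 ++ t); split.
  - rewrite cat_subseq //= eqxx YE cat_subseq // subseq_nseq_cnt //.
    apply: leq_trans (@unmatched0_prefix i Y1 Y2 _); last by rewrite -YE.
    have : count_mem i (nseq c i) <= count_mem i Y1 by apply: leq_count_subseq.
    by rewrite count_nseq /= eqxx mul1n.
  - have st : sorted leq t by apply: subseq_sorted srt3; [exact: leq_trans|exact: suffix_subseq].
    rewrite leq_catE srt1 /=; apply/and3P; split.
    + by apply/allP => x /(allP a1); lia.
    + rewrite all_cat; apply/andP; split; first by apply/allP => x /nseqP[->].
      exact: ta.
    + elim: c {e3 sub3 srt3 a3 sY1} => //= c IH; rewrite (path_sortedE leq_trans) IH andbT.
      by rewrite all_cat; apply/andP; split; first by apply/allP => x /nseqP[->].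
  - by rewrite -sz e e3 !size_cat /= !size_cat !size_nseq.
case/subseq_mid: sub => [|[s1 [s3 [e sub1 sub3]]]].
  by exists s; split=> //; apply: subseq_mid_sub.
move: srt; rewrite e leq_catE => /and4P[srt1 a1 a3 srt3].
have [c [t [e1 ta]]] := sorted_leq_split_l srt1 a1.
rewrite e1 in sub1 srt1 a1.
have [X1 [X2 [XE sX1 sX2]]] := subseq_cat_split sub1.
exists (t ++ nseq c i ++ i :: s3); split.
- rewrite XE -catA cat_subseq // cat_subseq //= ?eqxx // subseq_nseq_cnt //.
  apply: leq_trans (@depth0_suffix i X1 X2 _); last by rewrite -XE.
  have : count_mem i.+1 (nseq c i.+1) <= count_mem i.+1 X2 by apply: leq_count_subseq.
  by rewrite count_nseq /= eqxx mul1n.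
- have st : sorted leq t by apply: subseq_sorted srt1; [exact: leq_trans|exact: prefix_subseq].
  have -> : nseq c i ++ i :: s3 = i :: nseq c i ++ s3.
    by elim: (c) => //= c' ->.
  rewrite leq_catE st ta /=; apply/andP; split.
    rewrite all_cat; apply/andP; split; first by apply/allP => x /nseqP[->].
    by apply/allP => x /(allP a3); lia.
  elim: c {e1 sub1 srt1 a1 sX2} => //= c IH; rewrite (path_sortedE leq_trans) IH andbT.
  rewrite all_cat; apply/andP; split; first by apply/allP => x /nseqP[->].
  by apply/allP => x /(allP a3); lia.
- by rewrite -sz e e1 !size_cat /= !size_nseq addnA.
Qed.

Lemma sorted_has_sub (R : rel nat) G : sorted R G <-> has_sub R (size G) G.
Proof.
split=> [h|[s [sub srt sz]]]; first by exists G.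
by rewrite -(_ : s = G) //; apply/eqP; rewrite -(size_subseq_leqif sub) sz.
Qed.

Lemma wstep_sorted_gtn i G G' : wstep i G G' -> sorted gtn G = sorted gtn G'.
Proof.
by move=> st; apply/idP/idP => /sorted_has_sub h; apply/sorted_has_sub; move: h;
  rewrite (wstep_size st) => /(has_sub_dec _ st).
Qed.

Lemma wstep_sorted_leq i G G' : wstep i G G' -> sorted leq G = sorted leq G'.
Proof.
by move=> st; apply/idP/idP => /sorted_has_sub h; apply/sorted_has_sub; move: h;
  rewrite (wstep_size st) => /(has_sub_inc _ st).
Qed.

(* A hook word read backwards is strictly decreasing, then weakly increasing. *)
Definition has_hook k G :=
  exists s1 s2, [/\ subseq (s1 ++ s2) G, sorted gtn s1, sorted leq s2
    & size (s1 ++ s2) = k].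

Lemma has_hookP k G : has_hook k G <->
  exists G1 G2 k1 k2, [/\ G = G1 ++ G2, has_sub gtn k1 G1, has_sub leq k2 G2
    & k = k1 + k2].
Proof.
split=> [[s1 [s2 [/subseq_cat_split[G1 [G2 [-> h1 h2]]] r1 r2 <-]]]|].
  exists G1, G2, (size s1), (size s2); rewrite size_cat.
  by split=> //; [exists s1|exists s2].
move=> [G1 [G2 [k1 [k2 [-> [s1 [h1 r1 e1]] [s2 [h2 r2 e2]] ->]]]]].
by exists s1, s2; rewrite size_cat e1 e2 cat_subseq.
Qed.

(** The word is cut where the hook turns. A step restricts to each piece, so the decreasing and the
    increasing half keep their lengths separately. *)
Lemma wstep_hook i k G G' : wstep i G G' -> has_hook k G <-> has_hook k G'.
Proof.
move=> st; split=> /has_hookP[G1 [G2 [k1 [k2 [e h1 h2 ->]]]]]; apply/has_hookP.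
  exists (take (size G1) G'), (drop (size G1) G'), k1, k2; rewrite cat_take_drop.
  split=> //.
    by apply/(has_sub_dec _ (wstep_take (size G1) st)); rewrite e take_size_cat.
  by apply/(has_sub_inc _ (wstep_drop (size G1) st)); rewrite e drop_size_cat.
exists (take (size G1) G), (drop (size G1) G), k1, k2; rewrite cat_take_drop.
split=> //.
  by apply/(has_sub_dec _ (wstep_take (size G1) st)); rewrite e take_size_cat.
by apply/(has_sub_inc _ (wstep_drop (size G1) st)); rewrite e drop_size_cat.
Qed.

Lemma hook_word_rev u : hook_word u <->
  u <> [::] /\ exists s1 s2, [/\ rev u = s1 ++ s2, sorted gtn s1 & sorted leq s2].
Proof.
split=> [[p /and3P[pu h1 h2]]|[u0 [s1 [s2 [e r1 r2]]]]].
  split; first by move=> e; rewrite e in pu.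
  exists (rev (drop p.+1 u)), (rev (take p.+1 u)).
  split; first by rewrite -rev_cat cat_take_drop.
    rewrite rev_sorted; apply: subseq_sorted h2; first exact: ltn_trans.
    have -> : drop p.+1 u = drop 1 (drop p u) by rewrite drop_drop add1n.
    exact: drop_subseq.
  by rewrite rev_sorted.
have uE : u = rev s2 ++ rev s1 by rewrite -rev_cat -e revK.
have {}r1 : sorted ltn (rev s1) by rewrite rev_sorted.
have {}r2 : sorted geq (rev s2) by rewrite rev_sorted.
case: (rev s1) (rev s2) r1 r2 uE => [|a t1] t2 r1 r2 uE {e s1 s2}.
  rewrite cats0 in uE; subst u.
  case/lastP: t2 u0 r2 => // t2 b _ r2; exists (size t2).
  rewrite /hook_word_at size_rcons leqnn /= take_oversize ?size_rcons // r2 /=.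
  by rewrite -cats1 drop_size_cat.
case/lastP: t2 r2 uE => [|t2 b] r2 uE.
  by exists 0; rewrite uE /hook_word_at /= take0.
have [ab|ba] := ltnP b a.
  exists (size t2); rewrite uE /hook_word_at size_cat size_rcons.
  rewrite take_size_cat ?size_rcons // r2 cat_rcons drop_size_cat //=.
  by rewrite ab -/(sorted ltn (a :: t1)) r1 !andbT; lia.
exists (size t2).+1; rewrite uE /hook_word_at size_cat size_rcons.
rewrite drop_size_cat ?size_rcons // r1 andbT -cat_rcons take_size_cat ?size_rcons //.
apply/andP; split; first by rewrite /=; lia.
by case: t2 r2 {uE} => [|c t2] /= r2; rewrite ?ba // rcons_path r2 last_rcons /=.
Qed.

Section Preservation.

Variables (n : nat) (la : seq nat).
Implicit Types (T U : filling n la).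

Definition rowfactor (A : Type) (w : seq A) k :=
  take (nth 0 la k) (drop (sumn (take k la)) w).

Lemma nth_rows_factor T k : nth [::] (rows T) k = rowfactor (revrow T) k.
Proof.
by rewrite /rowfactor -nth_reshape; have := flattenK (rows T); rewrite shape_rows => <-.
Qed.

Lemma unprimed_rowE T (i : 'I_(size la)) :
  unprimed_row T i = rev (rowfactor (tabw T) i).
Proof.
rewrite /rowfactor /tabw /abs -map_drop -map_take -/(rowfactor _ _) -nth_rows_factor.
by rewrite nth_rows map_rev revK.
Qed.

Lemma primed_trow T (i : 'I_(size la)) :
  map primed (trow T i) = rev (rowfactor (tabp T) i).
Proof.
rewrite /rowfactor /tabp -map_drop -map_take -/(rowfactor _ _) -nth_rows_factor.
by rewrite nth_rows map_rev revK.
Qed.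

Lemma size_rowfactor T (i : 'I_(size la)) : size (rowfactor (tabw T) i) = nth 0 la i.
Proof. by rewrite -size_rev -unprimed_rowE size_map size_trow. Qed.

Lemma primed_entry T (i : 'I_(size la)) (j : 'I_(nth 0 la i)) :
  primed (entry T (mkbox j)) = nth false (rev (rowfactor (tabp T) i)) j.
Proof.
by rewrite -primed_trow (nth_map letter0) ?size_trow // nth_trow.
Qed.

Lemma entry_positive T :
  (forall b, 0 < absval (entry T b)) <-> 0 \notin tabw T.
Proof.
split=> h.
  apply/negP => /mapP[x /flatten_mapP[i _]]; rewrite mem_rev => /mapP[j _ ->] e.
  by have := h (mkbox j); rewrite -e.
case=> i j; rewrite lt0n; apply: contra h => /eqP e.
apply/mapP; exists (entry T (mkbox j)) => //; apply/flatten_mapP; exists i.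
  by rewrite mem_enum.
by rewrite mem_rev; apply/mapP; exists j; rewrite ?mem_enum.
Qed.

Lemma rowfactor_cat T (i i' : 'I_(size la)) : i' = i.+1 :> nat ->
  rowfactor (tabw T) i ++ rowfactor (tabw T) i' =
  take (nth 0 la i + nth 0 la i') (drop (sumn (take i la)) (tabw T)).
Proof.
move=> e; rewrite takeD drop_drop; congr (_ ++ take _ (drop _ _)).
by rewrite e (take_nth 0) // sumn_rcons addnC.
Qed.

Definition max_hook_rows T := forall (i i' : 'I_(size la)) k, i' = i.+1 :> nat ->
  has_hook k (rowfactor (tabw T) i ++ rowfactor (tabw T) i') -> k <= nth 0 la i.

Lemma max_hook_rowsP T : (forall i, hook_word (unprimed_row T i)) ->
  (forall i i' : 'I_(size la), i' = i.+1 :> nat ->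
     max_hook_subword (unprimed_row T i) (unprimed_row T i' ++ unprimed_row T i)) <->
  max_hook_rows T.
Proof.
move=> hooks; split=> h i i' => [k|] e.
  move=> [s1 [s2 [sub r1 r2 <-]]].
  have [_ _ hm] := h _ _ e.
  have <- : size (unprimed_row T i) = nth 0 la i by rewrite unprimed_rowE size_rev size_rowfactor.
  have [e0|ne0] := altP (s1 ++ s2 =P [::]); first by rewrite e0.
  rewrite -size_rev; apply: hm.
    apply/hook_word_rev; split; last by exists s1, s2; rewrite revK.
    by move/(congr1 rev); rewrite revK; apply/eqP.
  by rewrite !unprimed_rowE -rev_cat subseq_rev.
split=> //; first exact: suffix_subseq.
move=> u /hook_word_rev[u0 [s1 [s2 [eu r1 r2]]]] sub.
rewrite unprimed_rowE size_rev size_rowfactor; apply: h e _.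
exists s1, s2; rewrite -eu size_rev; split=> //.
by move: sub; rewrite !unprimed_rowE -rev_cat -subseq_rev revK.
Qed.

Lemma hook_word_atE p v : hook_word_at p v =
  [&& p < size v, sorted leq (drop (size v - p.+1) (rev v))
    & sorted gtn (take (size v - p) (rev v))].
Proof.
rewrite /hook_word_at; case: ltnP => //= pv.
by rewrite drop_rev take_rev !subKn ?rev_sorted // ltnW.
Qed.

(** Each clause of [DecTab] concerns contiguous factors of the reading word: a row, a part of a row
    cut at a candidate middle element, or two consecutive rows. Positivity of i keeps letters of
    absolute value 0 from becoming 1. *)
Lemma DecTab_step i T U : tab_f i T = Some U -> 0 < i -> DecTab T <-> DecTab U.
Proof.
move=> /tab_fP st i0.
have pE : tabp U = tabp T by rewrite /tabp (fstep_primed st).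
have ws : wstep i (tabw T) (tabw U).
  have [X [Y [e1 e2 dX uY]]] := fstep_abs st.
  by rewrite /tabw e2; apply: WMove.
have zeroE : (0 \in tabw T) = (0 \in tabw U).
  have [X [Y [e1 e2 dX uY]]] := fstep_abs st.
  rewrite /tabw e1 e2 !mem_cat !in_cons; have -> : (0 == i) = false by lia.
  by [].
have wrow k : wstep i (rowfactor (tabw T) k) (rowfactor (tabw U) k).
  exact/wstep_take/wstep_drop.
have hookE p k : hook_word_at p (unprimed_row T k) = hook_word_at p (unprimed_row U k).
  rewrite !unprimed_rowE !hook_word_atE !revK !size_rev !size_rowfactor.
  congr [&& _, _ & _].
    exact/wstep_sorted_leq/wstep_drop.
  exact/wstep_sorted_gtn/wstep_take.
have hooksE : (forall k, hook_word (unprimed_row T k)) <->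
              (forall k, hook_word (unprimed_row U k)).
  by split=> h k; have [p hp] := h k; exists p; rewrite ?hookE // -hookE.
have maxE : max_hook_rows T <-> max_hook_rows U.
  split=> h k k' c e hc; apply: h (e) _; move: hc; rewrite !rowfactor_cat //.
    by move/(wstep_hook _ (wstep_take _ (wstep_drop _ ws))).
  by move/(wstep_hook _ (wstep_take _ (wstep_drop _ ws))).
have prE b : primed (entry T b) = primed (entry U b).
  by case: b => k j; rewrite !primed_entry pE.
split=> -[h1 h2 h3 h4].
  have h2' := h2; move/hooksE in h2'.
  split=> //.
  - by apply/entry_positive; rewrite -zeroE; apply/entry_positive.
  - by apply/(max_hook_rowsP h2')/maxE/(max_hook_rowsP h2).
  - by move=> b; rewrite -prE -hookE; apply: h4.
have h2' := h2; move/hooksE in h2'.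
split=> //.
- by apply/entry_positive; rewrite zeroE; apply/entry_positive.
- by apply/(max_hook_rowsP h2')/maxE/(max_hook_rowsP h2).
- by move=> b; rewrite prE hookE; apply: h4.
Qed.

Lemma DecTab_sigma i T : 0 < i -> DecTab (sigma i T) <-> DecTab T.
Proof.
move=> i0; apply: (@sigma_ind n la i (fun U => DecTab U <-> DecTab T)) => // U V.
by move=> /DecTab_step /(_ i0) ->.
Qed.

Lemma DecTab_sigma_w0 T : DecTab (sigma_w0 T) <-> DecTab T.
Proof.
rewrite sigma_w0E; have : all (fun i => 0 < i) (w0word 0 n.-1).
  by apply/allP => i /mem_w0word/andP[].
elim: (w0word _ _) => //= i s IH /andP[i0 /IH <-]; exact: DecTab_sigma.
Qed.

End Preservation.

(** * The extremal words *)

Lemma strict_at_count x d P Q : strict_at x d (P ++ x :: Q) ->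
  cnt x P + 2 <= d + cnt x.+1 P.
Proof.
elim: P d => [|y P IH] d /=.
  have -> : (x == x.+1) = false by lia.
  by rewrite eqxx !cnt_nil => /andP[]; lia.
rewrite !cnt_cons; case: (y =P x.+1) => [->|n1].
  by have -> : (x.+1 == x) = false; [lia|move/IH; lia].
case: (y =P x) => [_|n2]; last by move/IH; lia.
by case/andP=> d1 /IH; lia.
Qed.

(** A repeated letter cannot lie in the strictly decreasing half, so the increasing half has begun
    before x. *)
Lemma no_plateau_drop t c x q s1 s2 : nseq t.+2 c ++ x :: q = s1 ++ s2 ->
  sorted gtn s1 -> sorted leq s2 -> c <= x.
Proof.
have inc t' : sorted leq (nseq t'.+1 c ++ x :: q) -> c <= x.
  rewrite -cat_rcons => /cat_sorted2[] + _; rewrite -cats1 (sorted_pairwise leq_trans).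
  by rewrite pairwise_cat => /andP[/allrelP h _]; apply: h; rewrite ?mem_nseq ?inE ?eqxx.
case: s1 => [|a [|b s1]] /= e r1 r2.
- by apply: (inc t.+1); rewrite -e in r2.
- by case: e r2 => _ <- r2; apply: (inc t).
- by case: e r1 => <- <- _; rewrite ltnn.
Qed.

Fixpoint low_word (c : nat) (mu : seq nat) : seq nat :=
  if mu is m :: mu' then nseq m c ++ low_word c.-1 mu' else [::].

Lemma strict_at_skip i d a x w : x != i.+1 -> x != i ->
  strict_at i d (nseq a x ++ w) = strict_at i d w.
Proof. by move=> h1 h2; elim: a => //= a ->; rewrite (negPf h1) (negPf h2). Qed.

Lemma strict_at_up i d a w : strict_at i d (nseq a i.+1 ++ w) = strict_at i (a + d) w.
Proof. by elim: a d => //= a IH d; rewrite eqxx IH addnS. Qed.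

Lemma strict_at_down i d a w : a < d ->
  strict_at i d (nseq a i ++ w) = strict_at i (d - a) w.
Proof.
elim: a d => [|a IH] d ad /=; first by rewrite subn0.
have -> : (i == i.+1) = false by lia.
rewrite eqxx IH; last by lia.
have -> /= : 1 < d by lia.
by congr (strict_at _ _ _); lia.
Qed.

Lemma low_word_le c mu x : x \in low_word c mu -> x <= c.
Proof.
elim: mu c => //= m mu IH c; rewrite mem_cat => /orP[/nseqP[->]//|/IH]; lia.
Qed.

Lemma strict_at_absent i d w : (forall x, x \in w -> x != i.+1 /\ x != i) ->
  strict_at i d w.
Proof.
elim: w => //= x w IH h; have [h1 h2] := h x (mem_head _ _).
by rewrite (negPf h1) (negPf h2) IH // => y yw; apply: h; rewrite inE yw orbT.
Qed.

Lemma strict_low_word c mu j : sorted gtn mu -> 0 < j < c ->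
  strict_at j 0 (low_word c mu).
Proof.
elim: mu c => //= m mu IH c srt jc.
have [cj|cj] := eqVneq c j.+1; last first.
  rewrite strict_at_skip ?IH //; [exact: path_sorted srt|lia|lia].
subst c; rewrite strict_at_up addn0 /=.
case: mu srt {IH} => //= m' mu /andP[mm' _].
rewrite strict_at_down //; apply: strict_at_absent => x /low_word_le; lia.
Qed.

Lemma subseq_cat_inv (T : eqType) (s G1 G2 : seq T) : subseq s (G1 ++ G2) ->
  exists t1 t2, [/\ s = t1 ++ t2, subseq t1 G1 & subseq t2 G2].
Proof.
case/subseqP=> m; rewrite size_cat => sm ->.
exists (mask (take (size G1) m) G1), (mask (drop (size G1) m) G2).
split; try exact: mask_subseq.
rewrite -mask_cat ?cat_take_drop // size_takel // sm; exact: leq_addr.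
Qed.

Lemma subseq_nseqE (T : eqType) (s : seq T) a x : subseq s (nseq a x) ->
  s = nseq (size s) x /\ size s <= a.
Proof.
move=> h; split; last by rewrite -(size_nseq a x) size_subseq.
by apply/all_pred1P/allP => y /(mem_subseq h)/nseqP[->] _; apply/eqP.
Qed.

(** With two letters c no d may follow; with at most one c there are at most b + 1 letters. *)
Lemma has_hook_two_rows k a b c d : d < c -> b < a ->
  has_hook k (nseq a c ++ nseq b d) -> k <= a.
Proof.
move=> dc ba [s1 [s2 [sub r1 r2 <-]]].
have [t1 [t2 [e /subseq_nseqE[e1 h1] /subseq_nseqE[e2 h2]]]] := subseq_cat_inv sub.
rewrite e size_cat.
case: (size t1) (size t2) h1 h2 e1 e2 => [|[|x]] [|y] h1 h2 e1 e2; try lia.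
by move: e; rewrite e1 e2 => /esym/no_plateau_drop => /(_ r1 r2); lia.
Qed.

Lemma hook_at_last p v : hook_word_at p v -> sorted geq v -> p.+1 = size v.
Proof.
move=> /and3P[pv _ h1] h2.
have : sorted geq (drop p v) by apply: drop_sorted.
have := size_drop p v; case: (drop p v) h1 => [|a [|b t]] /=; try lia.
Qed.

Lemma hook_at_nseq m c : hook_word_at m (nseq m.+1 c).
Proof.
rewrite /hook_word_at size_nseq ltnSn take_oversize ?size_nseq //=.
apply/andP; split; first by elim: m => //= m ->; rewrite leqnn.
have -> : c :: nseq m c = nseq m c ++ [:: c] by elim: m => //= m ->.
by rewrite drop_size_cat ?size_nseq.
Qed.

Lemma nth_low_word k c mu : k < size mu ->
  rowfactor mu (low_word c mu) k = nseq (nth 0 mu k) (c - k).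
Proof.
rewrite /rowfactor; elim: mu c k => [|m mu IH] c [|k] //= kmu.
  by rewrite drop0 take_size_cat ?size_nseq // subn0.
rewrite drop_cat size_nseq ltnNge leq_addr /= addKn IH //; congr nseq; lia.
Qed.

Lemma size_low_word c mu : size (low_word c mu) = sumn mu.
Proof. by elim: mu c => //= m mu IH c; rewrite size_cat size_nseq IH. Qed.

Section LowRows.

Variables (n : nat) (la : seq nat).
Hypotheses (la_strict : strict_partition la) (la_size : size la <= n).
Implicit Types (T U : filling n la).

Lemma la_sorted : sorted gtn la. Proof. by case/andP: la_strict. Qed.

Lemma nth_la_gt0 i : i < size la -> 0 < nth 0 la i.
Proof.
move=> ila; case/andP: la_strict => _; rewrite lt0n; apply: contra => /eqP <-.
exact: mem_nth.
Qed.

Lemma nth_la_lt i : i.+1 < size la -> nth 0 la i.+1 < nth 0 la i.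
Proof.
move=> ila; have tr : transitive gtn by move=> x y z /= h1 h2; apply: ltn_trans h2 h1.
have := la_sorted; rewrite (sorted_pairwise tr) => /(pairwiseP 0) h.
by apply: (h i i.+1); rewrite ?inE //; apply: ltnW.
Qed.

Lemma factors_inj (A : Type) (v w : seq A) : size v = sumn la -> size w = sumn la ->
  (forall k, k < size la -> rowfactor la v k = rowfactor la w k) -> v = w.
Proof.
move=> sv sw h; rewrite -(@reshapeKr _ la v) ?sv // -(@reshapeKr _ la w) ?sw //.
have sr (u : seq A) : size u = sumn la -> size (reshape la u) = size la.
  by move=> su; rewrite -(size_map size) -/(shape _) reshapeKl // su.
congr flatten; apply: (eq_from_nth (x0 := [::])); rewrite !sr // => k kla.
by rewrite !nth_reshape; apply: h.
Qed.

Lemma size_tabw T : size (tabw T) = sumn la.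
Proof. by rewrite size_map; case/andP: (fits_revrow T) => /eqP. Qed.

Lemma size_tabp T : size (tabp T) = sumn la.
Proof. by rewrite size_map; case/andP: (fits_revrow T) => /eqP. Qed.

Lemma tabw_le T x : x \in tabw T -> x <= n.
Proof. by move=> /mapP[y yT ->]; case/andP: (fits_revrow T) => _ /allP; apply. Qed.

Lemma take_rows (A : Type) (w : seq A) i : i < size la ->
  take (sumn (take i.+1 la)) w = take (sumn (take i la)) w ++ rowfactor la w i.
Proof. by move=> ila; rewrite (take_nth 0) // sumn_rcons takeD. Qed.

Lemma row_split (A : Type) (w : seq A) i : i < size la ->
  w = take (sumn (take i la)) w ++ rowfactor la w i ++ drop (sumn (take i.+1 la)) w.
Proof. by move=> ila; rewrite catA -take_rows // cat_take_drop. Qed.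

(* The maximality of row i as a hook keeps the letters of row i+1 below n - i,
   and strictness then leaves no other letter than n - i - 1. *)
Lemma strict_low_rows T : DecTab T ->
  (forall j, 0 < j <= n.-1 -> strict_at j 0 (tabw T)) ->
  tabw T = low_word n la.
Proof.
move=> [pos hooks maxh _] str.
move/(max_hook_rowsP hooks) in maxh; move/entry_positive in pos.
have gen i : i <= size la ->
    all (fun x => n < x + i) (take (sumn (take i la)) (tabw T)) /\
    forall k, k < i -> rowfactor la (tabw T) k = nseq (nth 0 la k) (n - k).
  elim: i => [|i IH] ila; first by rewrite take0 take0.
  have [P_ge rows_lt] := IH (ltnW ila).
  set P := take _ _ in P_ge; pose r := rowfactor la (tabw T) i.
  have wE := row_split (tabw T) ila; rewrite -/P -/r in wE.
  have sr : size r = nth 0 la i by have := size_rowfactor T (Ordinal ila).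
  have r_le x : x \in r -> x <= n - i.
    move=> xr; case: i ila {IH wE sr P_ge P} @r rows_lt xr => [|i] ila r rows_lt xr.
      by rewrite subn0; apply: (@tabw_le T); apply: mem_drop (mem_take xr).
    rewrite leqNgt; apply/negP => xi.
    (* Row i is constant equal to n - i, so a letter x >= n - i of the next row would extend it to a
       longer weakly increasing word. *)
    have := maxh (Ordinal (ltnW ila)) (Ordinal ila) (nth 0 la i).+1 erefl.
    rewrite /= rows_lt // ltnn => hh; suff: false by []; apply: hh;
      exists [::], (rcons (nseq (nth 0 la i) (n - i)) x).
    split=> //; last by rewrite size_rcons size_nseq.
      by rewrite cat0s -cats1 cat_subseq // sub1seq.
    rewrite (sorted_pairwise leq_trans) -cats1 pairwise_cat /= !andbT; apply/andP; split.
      by apply/allrelP => y z /nseqP[-> _]; rewrite inE => /eqP->; lia.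
    by rewrite -(sorted_pairwise leq_trans); elim: (nth 0 la i) => // -[|l] //= ->; rewrite leqnn.
  have rE : r = nseq (nth 0 la i) (n - i).
    rewrite -sr; apply/all_pred1P; case: allP => //= nall; exfalso.
    have /allPn[x0 x0r x0n] : ~~ all (pred1 (n - i)) r by apply/allP.
    pose t := find (predC1 (n - i)) r.
    have tr : t < size r by rewrite -has_find; apply/hasP; exists x0.
    have rt : take t r = nseq t (n - i).
      have -> : nseq t (n - i) = nseq (size (take t r)) (n - i) by rewrite size_takel // ltnW.
      apply/all_pred1P; apply/(all_nthP 0) => l; rewrite size_takel ?(ltnW tr) // => lt.
      by rewrite nth_take //; have := before_find 0 lt => /= /negbFE.
    pose x := nth 0 r t; have xn : x != n - i by have /= := @nth_find _ 0 (predC1 (n - i)) r;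
      apply; rewrite has_find.
    have xr : x \in r by rewrite mem_nth.
    have x_lt : x < n - i by have := r_le x xr; lia.
    have r_split : r = nseq t (n - i) ++ x :: drop t.+1 r.
      by rewrite -rt -drop_nth // cat_take_drop.
    have x0' : 0 < x.
      rewrite lt0n; apply: contra pos => /eqP <-.
      by rewrite wE !mem_cat xr orbT.
    (* Strictness asks for two letters x + 1 before x. They do not occur in P, so they belong to the
       initial run of n - i; but a hook cannot drop after a plateau. *)
    have := str x; rewrite wE r_split -!catA catA => /(_ _)/strict_at_count.
    rewrite !cnt_cat => /(_ ltac:(lia)); have -> : cnt x.+1 P = 0.
      by apply: cnt_notin; apply/negP => /(allP P_ge); lia.
    have := count_size (pred1 x.+1) (nseq t (n - i)); rewrite size_nseq -/(cnt _ _) => c1 c2.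
    have [_ [s1 [s2 [e r1 r2]]]] := iffLR (hook_word_rev _) (hooks (Ordinal ila)).
    rewrite unprimed_rowE revK /= -/r r_split in e.
    case: (t) c1 c2 e => [|[|t']] c1 c2 e; try lia.
    by have := no_plateau_drop e r1 r2; lia.
  split; last first.
    by move=> k; rewrite ltnS leq_eqVlt => /orP[/eqP->|/rows_lt].
  rewrite take_rows // all_cat -/P -/r rE; apply/andP; split.
    by apply: sub_all P_ge => x; lia.
  by apply/allP => x /nseqP[->]; lia.
have [_ rowsE] := gen (size la) (leqnn _).
apply: factors_inj; rewrite ?size_tabw ?size_low_word // => k kla.
by rewrite rowsE // nth_low_word.
Qed.

Lemma low_primed_last T : DecTab T -> (forall i, sorted geq (unprimed_row T i)) ->
  forall b : box la, primed (entry T b) -> (tagged b).+1 = nth 0 la (tag b).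
Proof.
move=> [_ _ _ h] srt b /h hb; have := hook_at_last hb (srt _).
by rewrite size_map size_trow.
Qed.

Lemma DecTab_low T : tabw T = low_word n la ->
  (forall b : box la, primed (entry T b) -> (tagged b).+1 = nth 0 la (tag b)) ->
  DecTab T.
Proof.
move=> wE pr.
have rowE (i : 'I_(size la)) : unprimed_row T i = nseq (nth 0 la i) (n - i).
  by rewrite unprimed_rowE wE nth_low_word // rev_nseq.
have hookE (i : 'I_(size la)) : hook_word_at (nth 0 la i).-1 (unprimed_row T i).
  have := nth_la_gt0 (ltn_ord i); rewrite rowE.
  by case: (nth 0 la i) => // m _; apply: hook_at_nseq.
have hooks i : hook_word (unprimed_row T i) by exists (nth 0 la i).-1.
split=> //.
- apply/entry_positive; rewrite wE; apply/negP => /nthP - /(_ 0)[k].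
  rewrite size_low_word => ks; rewrite -wE.
  have : nth 0 (tabw T) k \in flatten (reshape la (tabw T)).
    by rewrite reshapeKr ?size_tabw // mem_nth ?size_tabw.
  case/flattenP=> r /(nthP [::])[i] + <- + e0; rewrite e0.
  rewrite -(size_map size) -/(shape _) reshapeKl ?size_tabw // => ila.
  rewrite nth_reshape -/(rowfactor _ _ _) wE nth_low_word // => /nseqP[]; lia.
- apply/(max_hook_rowsP hooks) => i i' k e; rewrite wE !nth_low_word //.
  apply: has_hook_two_rows; first by have := ltn_ord i; have := ltn_ord i'; lia.
  by rewrite e; apply: nth_la_lt; rewrite -e.
- by move=> b /pr e; have := hookE (tag b); rewrite (_ : _.-1 = tagged b) // -(congr1 predn e).
Qed.

End LowRows.

(** The first row of T^highest in reverse reading order: its k-th border strip contributes mu_k -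
    mu_(k+1) boxes. *)
Fixpoint high_row (mu : seq nat) : seq nat :=
  if mu is m :: mu' then nseq (m - head 0 mu') 1 ++ map S (high_row mu') else [::].

Fixpoint high_word (mu : seq nat) : seq nat :=
  if mu is m :: mu' then high_row mu ++ high_word mu' else [::].

Arguments high_row : simpl never.
Arguments high_word : simpl never.

Lemma high_rowE m mu :
  high_row (m :: mu) = nseq (m - head 0 mu) 1 ++ map S (high_row mu).
Proof. by []. Qed.

Lemma high_wordE m mu : high_word (m :: mu) = high_row (m :: mu) ++ high_word mu.
Proof. by []. Qed.

Lemma size_high_row mu : sorted gtn mu -> size (high_row mu) = head 0 mu.
Proof.
elim: mu => // m mu IH /= srt; rewrite high_rowE size_cat size_nseq size_map IH;
  last exact: path_sorted srt.
by case: mu srt {IH} => [|m' mu] /=; lia.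
Qed.

Lemma size_high_word mu : sorted gtn mu -> size (high_word mu) = sumn mu.
Proof.
elim: mu => // m mu IH srt; rewrite high_wordE.
by rewrite (size_cat (high_row (m :: mu))) size_high_row // IH //; apply: path_sorted srt.
Qed.

Lemma high_row_bounds mu : all (fun x => 0 < x <= size mu) (high_row mu).
Proof.
elim: mu => //= m mu IH; rewrite high_rowE all_cat all_map; apply/andP; split.
  by apply/allP => x /nseqP[->].
by apply: sub_all IH => x /=; lia.
Qed.

Lemma high_row_sorted mu : sorted leq (high_row mu).
Proof.
elim: mu => //= m mu IH; rewrite high_rowE (sorted_pairwise leq_trans) pairwise_cat.
rewrite -!(sorted_pairwise leq_trans); apply/and3P; split.
- by apply/allrelP => x y /nseqP[-> _] /mapP[z _ ->].
- by elim: (m - _) => // -[|l] //=.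
- by rewrite sorted_map.
Qed.

Definition upto (j : nat) := filter (fun x => x <= j).
Definition above (j : nat) := filter (fun x => j < x).

Lemma sorted_upto_above j s : sorted leq s -> s = upto j s ++ above j s.
Proof.
elim: s => //= x s IH srt; have [xj|jx] := leqP x j.
  by rewrite /= -IH //; apply: path_sorted srt.
have all_s : all (fun y => j < y) s.
  move: srt; rewrite (path_sortedE leq_trans) => /andP[/allP h _].
  by apply/allP => y /h; lia.
rewrite /upto /above (all_filterP all_s).
suff -> : [seq y <- s | y <= j] = [::] by [].
by apply/eqP; rewrite -(negbK (_ == _)) -has_filter; apply/hasPn => y /(allP all_s); lia.
Qed.

Lemma scan_upto j d s : all (fun x => x <= j) s ->
  depth j d s = d - cnt j s /\ unmatched j d s = cnt j s - d.
Proof.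
elim: s d => [|x s IH] d /=; first by rewrite cnt_nil subn0.
case/andP=> xj h; rewrite cnt_cons.
have -> : (x == j.+1) = false by lia.
case: (x =P j) => _; [have [-> ->] := IH d.-1 h|have [-> ->] := IH d h]; split; lia.
Qed.

Lemma scan_above j d s : all (fun x => j < x) s ->
  depth j d s = d + cnt j.+1 s /\ unmatched j d s = 0.
Proof.
elim: s d => [|x s IH] d /=; first by rewrite cnt_nil addn0.
case/andP=> xj h; rewrite cnt_cons.
have -> : (x == j) = false by lia.
case: (x =P j.+1) => _; [have [-> ->] := IH d.+1 h|have [-> ->] := IH d h]; split; lia.
Qed.

Lemma cnt_high_row_S j m mu : 0 < j ->
  cnt j.+1 (high_row (m :: mu)) = cnt j (high_row mu).
Proof.
move=> j0; rewrite high_rowE cnt_cat.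
rewrite [cnt _ (nseq _ _)]cnt_notin; last by rewrite mem_nseq; lia.
by rewrite /cnt count_map; apply: eq_count => x /=.
Qed.

Lemma all_upto j s : all (fun x => x <= j) (upto j s).
Proof. exact: filter_all. Qed.

Lemma all_above j s : all (fun x => j < x) (above j s).
Proof. exact: filter_all. Qed.

Lemma cnt_upto j s : cnt j (upto j s) = cnt j s.
Proof.
by rewrite /cnt count_filter; apply: eq_count => x /=; case: eqP => //= ->; rewrite leqnn.
Qed.

Lemma cnt_above j s : cnt j.+1 (above j s) = cnt j.+1 s.
Proof.
by rewrite /cnt count_filter; apply: eq_count => x /=; case: eqP => //= ->; rewrite leqnn.
Qed.

Definition balanced j w := depth j 0 w = 0 /\ unmatched j 0 w = 0.

(* Row i has as many letters j+1 as row i+1 has letters j. *)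
Lemma scan_high_word j mu : 0 < j ->
  depth j (cnt j (high_row mu)) (high_word mu) = 0 /\
  unmatched j (cnt j (high_row mu)) (high_word mu) = 0.
Proof.
move=> j0; elim: mu => // m mu [IH1 IH2].
rewrite high_wordE.
have := cnt_high_row_S m mu j0; have := high_row_sorted (m :: mu).
move: (high_row (m :: mu)) => r /(sorted_upto_above j) rE cE.
have -> : r ++ high_word mu = upto j r ++ above j r ++ high_word mu by rewrite catA -rE.
rewrite !depth_cat !unmatched_cat.
have [-> ->] := scan_upto (cnt j r) (all_upto j r); rewrite cnt_upto subnn.
by have [-> ->] := scan_above 0 (all_above j r); rewrite cnt_above cE.
Qed.

Lemma balanced_above j m mu : 0 < j ->
  balanced j (above j (high_row (m :: mu)) ++ high_word mu).
Proof.
move=> j0; rewrite /balanced depth_cat unmatched_cat.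
have [-> ->] := scan_above 0 (all_above j (high_row (m :: mu))).
by rewrite cnt_above cnt_high_row_S //; apply: scan_high_word.
Qed.

Lemma high_word_cons m mu j : high_word (m :: mu) =
  upto j (high_row (m :: mu)) ++ above j (high_row (m :: mu)) ++ high_word mu.
Proof. by rewrite high_wordE [RHS]catA -sorted_upto_above //; apply: high_row_sorted. Qed.

Definition raise j x := if x == j then j.+1 else x.

Lemma fmax_front j P E : j.+1 \notin P -> balanced j E ->
  fmax j 0 (P ++ E) = map (raise j) P ++ E /\ depth j 0 (P ++ E) = 0.
Proof.
move=> jP [dE uE]; rewrite fmax_cat depth_cat.
have [-> ->] : fmax j 0 P = map (raise j) P /\ depth j 0 P = 0.
  elim: P jP => //= x P IH; rewrite inE negb_or eq_sym => /andP[xj /IH[e1 e2]].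
  by rewrite (negPf xj) /raise; case: (x =P j) => _; rewrite /= e1 e2.
by rewrite fmax_id.
Qed.

Lemma balanced_nil j : balanced j [::]. Proof. by []. Qed.

Lemma notin_upto j k s : j < k -> k \notin upto j s.
Proof. by move=> jk; apply/negP => /(allP (all_upto j s)); lia. Qed.

Lemma notin_above j k s : k <= j -> k \notin above j s.
Proof. by move=> jk; apply/negP => /(allP (all_above j s)); lia. Qed.

Lemma raise_notin j s : j \notin map (raise j) s.
Proof.
by apply/negP => /mapP[x _]; rewrite /raise; case: eqP => [_|ne e]; [lia|case: ne].
Qed.

Lemma raise_notin_other j k s : k != j.+1 -> k \notin s -> k \notin map (raise j) s.
Proof.
move=> kj ks; apply/negP => /mapP[x xs]; rewrite /raise; case: eqP => _ e.
  by rewrite e eqxx in kj.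
by rewrite e xs in ks.
Qed.

(** The letters j + 1 of each row are matched exactly with the letters j of the next one, so only Q
    and the beginning of the first row are exposed to F_j. *)
Lemma fmax_high_word j Q mu : 0 < j -> j.+1 \notin Q ->
  depth j 0 (Q ++ high_word mu) = 0 /\
  fmax j 0 (Q ++ high_word mu) =
  map (raise j) (Q ++ upto j (high_row mu)) ++
    above j (high_row mu) ++ high_word (behead mu).
Proof.
move=> j0 jQ; case: mu => [|m mu].
  by rewrite /high_word /high_row /= !cats0; have := fmax_front jQ (balanced_nil j);
    rewrite !cats0 => -[-> ->].
rewrite (high_word_cons m mu j) (catA Q).
have [|-> ->] // := @fmax_front j (Q ++ upto j (high_row (m :: mu))) _ _ (balanced_above m mu j0).
by rewrite mem_cat negb_or jQ notin_upto.
Qed.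

Lemma highest_high_word m mu : highest_word m (high_word mu).
Proof.
by move=> j /andP[j0 _]; have [] := @fmax_high_word j [::] mu j0 isT.
Qed.

Lemma fmaxs_desc_high_row k m mu :
  fmaxs (desc_iota k) (high_word (m :: mu)) =
  map (maxn k.+1) (high_row (m :: mu)) ++ high_word mu.
Proof.
set r := high_row (m :: mu).
elim: k => [|k IH].
  rewrite /= high_wordE -/r; congr (_ ++ _); symmetry.
  rewrite -[RHS]map_id; apply/eq_in_map => x /(allP (high_row_bounds (m :: mu))).
  by lia.
rewrite desc_iotaS /= IH.
have rE := sorted_upto_above k.+1 (high_row_sorted (m :: mu)); rewrite -/r in rE.
have aE l : l <= k.+2 -> map (maxn l) (above k.+1 r) = above k.+1 r.
  move=> lk; rewrite -[RHS]map_id; apply/eq_in_map => x /(allP (all_above _ _)); lia.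
rewrite {1}rE map_cat aE // -catA.
have [|-> _] := @fmax_front k.+1 (map (maxn k.+1) (upto k.+1 r)) _ _ (balanced_above m mu (ltn0Sn k)).
  by apply/negP => /mapP[x /(allP (all_upto _ _))]; lia.
rewrite -/r [in RHS]rE map_cat aE // -catA -map_comp; congr (_ ++ _).
by apply/eq_in_map => x /(allP (all_upto _ _)) xk; rewrite /= /raise; case: eqP; lia.
Qed.

Lemma fmaxs_nil s : fmaxs s [::] = [::].
Proof. by elim: s => //= i s ->. Qed.

Lemma fmaxs_nseq_skip s m x w : all (fun i => i.+1 < x) s ->
  fmaxs s (nseq m x ++ w) = nseq m x ++ fmaxs s w.
Proof.
elim: s => //= i s IH /andP[ix /IH->].
elim: m {IH} => //= m ->; have -> : (x == i.+1) = false by lia.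
by have -> : (x == i) = false by lia.
Qed.

(** The first cycle to act makes the first row constant and equal to the largest letter; the later
    cycles ignore it and treat the other rows in rank one less. *)
Lemma fmaxs_w0word_high k mu : sorted gtn mu -> size mu <= k.+1 ->
  fmaxs (w0word 0 k) (high_word mu) = low_word k.+1 mu.
Proof.
elim: k mu => [|k IH] [|m mu] srt szmu; rewrite ?fmaxs_nil //.
  by case: mu szmu srt => // _ _; rewrite w0word_nil high_wordE high_rowE /= !cats0 subn0.
rewrite w0word_rcons // fmaxs_cat fmaxs_desc_high_row.
have -> : map (maxn k.+2) (high_row (m :: mu)) = nseq m k.+2.
  rewrite -[m in RHS]/(head 0 (m :: mu)) -size_high_row // -(size_map (maxn k.+2)).
  apply/all_pred1P; rewrite all_map; apply: sub_all (high_row_bounds _) => x /=.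
  by move: szmu; rewrite /=; lia.
rewrite fmaxs_nseq_skip; last by apply/allP => i /mem_w0word; lia.
by rewrite IH //; apply: path_sorted srt.
Qed.

(** Each pair F_(a+1) F_a sweeps the letters a and a + 1 out of Q and one more row, leaving the
    later rows intact. For a = 1 the first letter among 1 and 2 then begins an untouched row, hence
    is 1. *)
Lemma fmaxs_zigzag_high a k mu : 0 < a -> exists Q,
  [/\ fmaxs (zigzag a k) (high_word mu) = Q ++ high_word (drop k mu),
      a \notin Q & a.+1 \notin Q].
Proof.
elim: k a => [|k IH] a a0; first by exists [::]; rewrite drop0.
have [Q [e Q1 Q2]] := IH a.+1 isT.
have -> : zigzag a k.+1 = a.+1 :: a :: zigzag a.+1 k by [].
rewrite /= e; set nu := drop k mu.
have [_ ->] := fmax_high_word nu a0 Q1.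
set r := high_row nu.
have -> : drop k.+1 mu = behead nu by rewrite /nu -drop1 drop_drop.
have aE : above a r = upto a.+1 (above a r) ++ above a.+1 r.
  have -> : above a.+1 r = above a.+1 (above a r).
    by rewrite /above -filter_predI; apply: eq_filter => x /=; lia.
  apply: sorted_upto_above; apply: sorted_filter; first exact: leq_trans.
  exact: high_row_sorted.
rewrite {1}aE -catA catA.
set P := map (raise a) _ ++ _.
have bal : balanced a.+1 (above a.+1 r ++ high_word (behead nu)).
  by rewrite /r; case: (nu) => [|m nu']; [exact: balanced_nil|exact: balanced_above].
have [|-> _] := @fmax_front a.+1 P _ _ bal.
  rewrite mem_cat negb_or raise_notin_other ?notin_upto //; first by lia.
  by rewrite mem_cat negb_or Q2 notin_upto //; lia.
exists (map (raise a.+1) P ++ above a.+1 r); split; first by rewrite catA.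
  rewrite mem_cat negb_or notin_above // andbT raise_notin_other //; first by lia.
  rewrite mem_cat negb_or raise_notin /=.
  apply/negP; rewrite mem_filter => /andP[_]; apply/negP; exact: notin_above.
by rewrite mem_cat negb_or raise_notin notin_above.
Qed.

Lemma high_word_head m mu : sorted gtn (m :: mu) -> 0 < m ->
  exists w, high_word (m :: mu) = 1 :: w.
Proof.
move=> srt m0; exists (behead (high_word (m :: mu))); rewrite high_wordE high_rowE.
have : 0 < m - head 0 mu by case: mu srt => [|m' mu] /=; [rewrite subn0|case/andP=> + _;
  rewrite subn_gt0].
by case: (m - _).
Qed.

Lemma starts_low_zigzag_high k mu : sorted gtn mu -> 0 \notin mu ->
  starts_low 1 (fmaxs (zigzag 1 k) (high_word mu)).
Proof.
move=> srt mu0; have [Q [-> Q1 Q2]] := @fmaxs_zigzag_high 1 k mu isT.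
elim: Q Q1 Q2 => [_ _|x Q IH] /=.
  case: (drop k mu) (drop_sorted k srt) (@mem_drop k _ mu) => // m nu srt' dr.
  have [|w ->] //= := high_word_head srt'; rewrite lt0n; apply: contra mu0 => /eqP <-.
  by apply: dr; rewrite mem_head.
rewrite !inE !negb_or ![_ == x]eq_sym => /andP[n1 h1] /andP[n2 h2].
by rewrite n2 IH // orbT.
Qed.

(** The letter a is cleared from the first k rows while row k + 1 stays intact; this locates the
    letter on which e_0 acts after the reversals. *)
Lemma fmaxs_iota_high a k mu : 0 < a -> sorted gtn mu -> valid (iota a k) (high_word mu) /\
  exists Q, [/\ fmaxs (iota a k) (high_word mu) = Q ++ high_word (drop k mu),
      a \notin Q & size Q = sumn (take k mu)].
Proof.
move=> + srt; elim: k a => [|k IH] a a0.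
  by split=> //; exists [::]; rewrite drop0 take0.
have [v [Q [e Q1 Q2]]] := IH a.+1 isT.
rewrite /= v e; set nu := drop k mu.
have [-> ->] := fmax_high_word nu a0 Q1; split=> //.
set r := high_row nu.
exists (map (raise a) (Q ++ upto a r) ++ above a r); split.
- have -> : drop k.+1 mu = behead nu by rewrite /nu -drop1 drop_drop.
  by rewrite catA.
- by rewrite mem_cat negb_or raise_notin notin_above.
- have rE := sorted_upto_above a (high_row_sorted nu).
  rewrite size_cat size_map size_cat -addnA -size_cat -rE size_high_row ?Q2;
    last exact: drop_sorted.
  have [kmu|kmu] := ltnP k (size mu).
    by rewrite /nu (take_nth 0) // sumn_rcons (drop_nth 0).
  by rewrite /nu !take_oversize ?drop_oversize ?addn0 // ltnW.
Qed.

Lemma index_iota_high k mu : sorted gtn mu -> 0 \notin mu -> k < size mu ->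
  index 1 (fmaxs (iota 1 k) (high_word mu)) = sumn (take k mu) /\
  1 \in fmaxs (iota 1 k) (high_word mu).
Proof.
move=> srt mu0 kmu; have [_ [Q [-> Q1 <-]]] := @fmaxs_iota_high 1 k mu isT srt.
have [||w e] := @high_word_head (nth 0 mu k) (drop k.+1 mu).
- by rewrite -drop_nth //; apply: drop_sorted.
- by rewrite lt0n; apply: contra mu0 => /eqP <-; apply: mem_nth.
rewrite (drop_nth 0 kmu) e index_cat (negPf Q1) /= addn0 mem_cat mem_head orbT //.
Qed.

(** From left to right, the entry with offset j is the number of parts exceeding j, which is the
    form in which [strip] presents the border strips. *)
Lemma nth_high_row mu j : sorted gtn mu -> j < head 0 mu ->
  let x := nth 0 (rev (high_row mu)) j in
  [/\ 0 < x, nth 0 mu x <= j & j < nth 0 mu x.-1].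
Proof.
elim: mu j => //= m mu IH j srt jm; rewrite high_rowE rev_cat -map_rev nth_cat.
have srt' := path_sorted srt.
rewrite size_map size_rev size_high_row //; case: (ltnP j (head 0 mu)) => jmu.
  rewrite (nth_map 0) ?size_rev ?size_high_row //.
  have := IH j srt' jmu; case: (nth 0 _ j) => [|x] /= []; first by lia.
  by [].
rewrite rev_nseq nth_nseq ifT /=; last by lia.
by rewrite nth0.
Qed.

Lemma nth_high_word mu i : sorted gtn mu -> i < size mu ->
  rowfactor mu (high_word mu) i = high_row (drop i mu).
Proof.
rewrite /rowfactor; elim: mu i => //= m mu IH [|i'] srt ila.
  by rewrite take0 !drop0 high_wordE take_size_cat ?size_high_row.
have srt' := path_sorted srt.
by rewrite high_wordE drop_cat size_high_row //= ltnNge leq_addr /= addKn IH.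
Qed.

(** * Border strips *)

Section BorderStrips.

Variable la : seq nat.
Hypothesis la_strict : strict_partition la.

Lemma nth_la_mono i k : i <= k -> nth 0 la k <= nth 0 la i.
Proof.
move=> ik; have [kla|kla] := ltnP k (size la); last by rewrite nth_default.
have tr : transitive gtn by move=> x y z /= h1 h2; apply: ltn_trans h2 h1.
have := la_sorted la_strict; rewrite (sorted_pairwise tr) => /(pairwiseP 0) h.
have [->//|ne] := eqVneq i k.
by apply: ltnW; apply: (h i k); rewrite ?inE; lia.
Qed.

Lemma nth_la_succ_lt i : 0 < nth 0 la i.+1 -> nth 0 la i.+1 < nth 0 la i.
Proof.
by move=> h; apply: nth_la_lt => //; rewrite ltnNge; apply/negP => /(nth_default 0) e;
  rewrite e in h.
Qed.

Lemma coord_inj : injective (@coord la).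
Proof.
move=> [i j] [i' j'] [/= /val_inj e]; subst i'; rewrite /tagged /= => h.
have -> // : j = j'.
by apply: val_inj => /=; lia.
Qed.

Lemma mem_coords (S : {set box la}) b : (coord b \in coords S) = (b \in S).
Proof. exact: (mem_image coord_inj). Qed.

Definition boxset (P : nat -> nat -> bool) : {set box la} :=
  [set b : box la | P (tag b) (tagged b)].

Lemma in_coordsP (S : {set box la}) i j : reflect
  (exists b : box la, [/\ b \in S, tag b = i :> nat & tagged b = j :> nat])
  ((i.+1, (i + j).+1) \in coords S).
Proof.
apply: (iffP imageP) => [[b bS [e1 e2]]|[b [bS e1 e2]]]; exists b => //.
  by split=> //; move: e2; rewrite e1 => /addnI->.
by rewrite -e1 -e2.
Qed.

Lemma mem_boxset P i j :
  ((i.+1, (i + j).+1) \in coords (boxset P)) = (j < nth 0 la i) && P i j.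
Proof.
apply/in_coordsP/andP => [[b [+ <- <-]]|[jla p]].
  by rewrite inE => p; split=> //; apply: ltn_ord.
have ila : i < size la by rewrite ltnNge; apply/negP => h; rewrite nth_default in jla.
by exists (@mkbox la (Ordinal ila) (Ordinal jla)); rewrite inE.
Qed.

Definition remaining k := boxset (fun i j => j < nth 0 la (i + k)).
Definition strip k := boxset (fun i j => nth 0 la (i + k.+1) <= j < nth 0 la (i + k)).

Lemma first_row_length_remaining k : first_row_length (remaining k) = nth 0 la k.
Proof.
rewrite /first_row_length.
case: (posnP (size la)) => [s0|s0].
  rewrite nth_default ?s0 //; apply/eqP; rewrite cards_eq0; apply/eqP/setP => b.
  by move: (ltn_ord (tag b)) => /leq_trans /(_ (eq_leq s0)).
have le := nth_la_mono (leq0n k).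
pose F (j : 'I_(nth 0 la k)) := @mkbox la (Ordinal s0) (widen_ord le j).
rewrite -[RHS]card_ord -(card_imset _ (_ : injective F)); last first.
  by move=> x y /(congr1 (@coord la)) [] /= ?; apply: val_inj.
apply: eq_card => b; rewrite !inE /=; apply/andP/imsetP => [[h /eqP [t0]]|[j _ ->]].
  have e : tag b + k = k by rewrite t0.
  rewrite e in h; exists (Ordinal h) => //; apply: coord_inj; congr (_.+1, _.+1) => //.
  exact (f_equal (fun x => x + nat_of_ord (tagged b)) t0).
by rewrite /= add0n.
Qed.

Lemma strip_condition_strip k : 0 < nth 0 la k ->
  strip_condition (remaining k) (strip k).
Proof.
move=> k0; apply/and3P; split.
- by apply/subsetP => b; rewrite !inE => /andP[].
- rewrite first_row_length_remaining -[nth 0 la k]prednK //.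
  rewrite -[in X in X \in _](add0n (nth 0 la k).-1) mem_boxset !add0n.
  have := nth_la_mono (leq0n k); have := nth_la_mono (leqnSn k).
  by case: (posnP (nth 0 la k.+1)) => [->|/nth_la_succ_lt]; lia.
- apply/allP => p /imageP[b + ->] /=; rewrite inE.
  case: b => i [j jla] /= /andP[h1 h2]; apply/implyP; case: j jla h1 h2 => [|j] jla h1 h2.
    by rewrite addn0 eqxx.
  move=> _; have -> : (i + j.+1).+1 = (i.+1 + j).+1 by lia.
  rewrite !mem_boxset; have -> : i + j.+1 = (i + j).+1 by lia.
  rewrite mem_boxset.
  have eA : i.+1 + k = i + k.+1 by lia.
  have eB : i.+1 + k.+1 = i + k.+2 by lia.
  rewrite eA eB.
  have leA : nth 0 la (i + k.+1) <= nth 0 la i.+1 by apply: nth_la_mono; lia.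
  have ltB : nth 0 la (i + k.+2) < nth 0 la (i + k.+1) \/ nth 0 la (i + k.+2) = 0.
    case: (posnP (nth 0 la (i + k.+2))) => [->|]; first by right.
    by rewrite [i + k.+2]addnS => /nth_la_succ_lt; left.
  by case: ifP; lia.
Qed.

(** Follow the strip from the end of the first row: it runs left as long as the box below is absent,
    and the first box present below is the last remaining box of the next row. *)
Lemma strip_condition_min k S : strip_condition (remaining k) S -> strip k \subset S.
Proof.
case/and3P=> _ first_in /allP closed.
have gen i j : nth 0 la (i + k.+1) <= j < nth 0 la (i + k) ->
    (i.+1, (i + j).+1) \in coords S.
  elim: i j => [|i IHi] j.
    rewrite !add0n => jk.
    have : (1, (0 + (nth 0 la k).-1).+1) \in coords S.
      by rewrite add0n prednK; [rewrite -first_row_length_remaining|lia].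
    rewrite (_ : (nth 0 la k).-1 = j + ((nth 0 la k).-1 - j)); last by lia.
    have : j + ((nth 0 la k).-1 - j) < nth 0 la k by lia.
    elim: (_ - j) => [|d IHd] jd; first by rewrite addn0.
    move=> /closed /=; rewrite add0n addnS /= => h; apply: IHd; first by lia.
    move: h; have -> : (2, (j + d).+2) = (2, (1 + (j + d)).+1) by [].
    by rewrite mem_boxset add1n [_ < nth 0 la k.+1]ltnNge (_ : nth 0 la k.+1 <= j + d) ?andbF //;
      lia.
  move=> jk; set c := nth 0 la (i.+1 + k) in jk.
  have : (i.+2, (i.+1 + c.-1).+1) \in coords S.
    have := IHi c; rewrite addnS -addSn -/c leqnn => /(_ _)/closed /= h.
    have c0 : 0 < c by lia.
    have : c < nth 0 la (i + k) by apply: nth_la_succ_lt; rewrite -addSn.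
    move=> /h; have -> : (i.+2, (i + c).+1) = (i.+2, (i.+1 + c.-1).+1) by congr (_, _); lia.
    rewrite mem_boxset -/c (_ : c.-1 < c) ?andbT; last by lia.
    have := nth_la_mono (leq_addr k i.+1); rewrite -/c => le.
    rewrite (_ : c.-1 < nth 0 la i.+1); last by lia.
    by case: eqP => //=; lia.
  rewrite (_ : c.-1 = j + (c.-1 - j)); last by lia.
  have : j + (c.-1 - j) < c by lia.
  elim: (_ - j) => [|d IHd] jd; first by rewrite addn0.
  move=> /closed /=; rewrite addnS /= => h; apply: IHd; first by lia.
  move: h; have -> : (i.+3, (i.+1 + (j + d).+1).+1) = (i.+3, (i.+2 + (j + d)).+1) by congr (_, _); lia.
  rewrite mem_boxset (_ : _ < nth 0 la (i.+2 + k) = false) ?andbF; last first.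
    have -> : i.+2 + k = i.+1 + k.+1 by lia.
    by case/andP: jk => jk _; apply/negbTE; rewrite -leqNgt (leq_trans jk) ?leq_addr.
  by rewrite addnS /=; case: eqP => //=; lia.
apply/subsetP => b; rewrite inE => /gen; by rewrite -[(_, _)]/(coord b) mem_coords.
Qed.

Lemma first_border_strip_remaining k : first_border_strip (remaining k) = strip k.
Proof.
rewrite /first_border_strip.
case: (posnP (nth 0 la k)) => [k0|k0].
  have sE : strip k = set0.
    apply/setP => b; rewrite !inE; have := nth_la_mono (leq_addl (tag b) k); lia.
  rewrite sE; case: pickP => //= S /minsetP[/and3P[sub first_in _] _].
  (* With an empty first row the required box would be (1, 0), but coordinates start at 1. *)
  move: first_in; rewrite first_row_length_remaining k0 => /imageP[b _ []]; lia.
case: pickP => [S /minsetP[cS minS]|/(_ (strip k))] /=.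
  by apply/esym/minS; [exact: strip_condition_strip|exact: strip_condition_min].
case: minsetP => // -[]; split; first exact: strip_condition_strip.
move=> S cS sub; apply/eqP; rewrite eqEsubset sub; exact: strip_condition_min.
Qed.

Lemma strips_removedE k : strips_removed la k = remaining k.
Proof.
elim: k => [|k IH] /=.
  by apply/setP => b; rewrite !inE addn0 ltn_ord.
rewrite IH first_border_strip_remaining; apply/setP => b; rewrite !inE.
have := nth_la_mono (leqnSn (tag b + k)); rewrite -addnS; lia.
Qed.

Lemma border_stripE k : border_strip la k = strip k.-1.
Proof. by rewrite /border_strip strips_removedE first_border_strip_remaining. Qed.

Lemma tabw_Thighest n : size la <= n -> tabw (Thighest n la) = high_word la.
Proof.
move=> la_n; have srt := la_sorted la_strict.
apply: factors_inj; rewrite ?size_tabw ?size_high_word // => i ila.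
pose o := Ordinal ila; rewrite -[i]/(val o).
have -> : rowfactor la (high_word la) o = high_row (drop i la).
  exact: nth_high_word.
rewrite -[LHS]revK -unprimed_rowE -[RHS]revK; congr rev.
have srt' : sorted gtn (drop i la) by apply: drop_sorted.
have hd : head 0 (drop i la) = nth 0 la i by rewrite -nth0 nth_drop addn0.
apply: (eq_from_nth (x0 := 0)).
  by rewrite size_map size_trow size_rev size_high_row.
move=> j; rewrite size_map size_trow => jla.
rewrite (nth_map letter0) ?size_trow // -[j in LHS]/(val (Ordinal jla)) nth_trow.
rewrite /entry /Thighest ffunE /absval /=.
have [|x0 x1 x2] := @nth_high_row (drop i la) j srt'; first by rewrite hd.
have xin : nth 0 (rev (high_row (drop i la))) j \in high_row (drop i la).
  by rewrite -mem_rev mem_nth // size_rev size_high_row ?hd.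
have := allP (high_row_bounds _) _ xin; rewrite size_drop.
move: (nth 0 _ j) x0 x1 x2 => x x0 x1 x2 xb; rewrite !nth_drop in x1 x2.
have xn : x < n.+1 by lia.
case: pickP => [k /andP[k0]|/(_ (Ordinal xn))] /=; rewrite border_stripE inE /= ?x0 /=.
  case: (nat_of_ord k) k0 => // k' _ /=.
  case: x x0 x1 x2 {xb xn xin} => // x _ /= x1 x2 /andP[k1 k2].
  have [h|h|->//] := ltngtP k' x.
    by have := nth_la_mono (_ : i + k'.+1 <= i + x); lia.
  by have := nth_la_mono (_ : i + x.+1 <= i + k'); lia.
by rewrite prednK // x1 x2.
Qed.

Lemma tabp_Thighest n : tabp (Thighest n la) = nseq (sumn la) false.
Proof.
rewrite -(size_tabp (Thighest n la)); apply/all_pred1P/allP => x.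
move=> /mapP[y /flatten_mapP[i _]]; rewrite mem_rev => /mapP[j _ ->] ->.
by rewrite /entry /Thighest ffunE.
Qed.

End BorderStrips.

Lemma high_word_le mu x : x \in high_word mu -> x <= size mu.
Proof.
elim: mu => // m mu IH; rewrite high_wordE mem_cat => /orP[|/IH]; last exact: leqW.
by move/(allP (high_row_bounds _)) => /andP[].
Qed.

Lemma index_low_word c mu k : 0 \notin mu -> k < size mu -> size mu <= c ->
  index (c - k) (low_word c mu) = sumn (take k mu).
Proof.
elim: mu c k => //= m mu IH c [|k]; rewrite inE negb_or => /andP[m0 mu0] kmu sz.
  by case: m m0 => //= m _; rewrite subn0 eqxx.
rewrite /= index_cat size_nseq mem_nseq.
have -> : (c - k.+1 == c) = false by lia.
rewrite andbF -(IH c.-1) //; last by lia.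
by congr (_ + index _ _); lia.
Qed.

Lemma mem_low_word c mu x : x \in low_word c mu -> exists2 k, k < size mu & x = c - k.
Proof.
elim: mu c => //= m mu IH c; rewrite mem_cat => /orP[/nseqP[-> _]|/IH[k kmu ->]].
  by exists 0; rewrite ?subn0.
by exists k.+1 => //; lia.
Qed.

Lemma last_in_low_word c mu k : 0 \notin mu -> k < size mu -> c - k \in low_word c mu.
Proof.
elim: mu c k => //= m mu IH c [|k]; rewrite inE negb_or => /andP[m0 mu0] kmu;
  rewrite mem_cat.
  by rewrite subn0 mem_nseq eqxx andbT lt0n eq_sym m0.
have -> : c - k.+1 = c.-1 - k by lia.
by rewrite IH ?orbT.
Qed.

(** * Highest and lowest weights *)

Section Main.

Variables (n : nat) (la : seq nat).
Hypotheses (n_ge2 : 2 <= n) (la_strict : strict_partition la) (la_size : size la <= n).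
Implicit Types (S T U : filling n la).

Let n_gt0 : 0 < n. Proof. exact: ltnW. Qed.
Let la_srt : sorted gtn la. Proof. exact: la_sorted. Qed.
Let la_pos : 0 \notin la. Proof. by case/andP: la_strict. Qed.

Lemma filling_with_abs T v : size v = sumn la -> (forall x, x \in v -> x <= n) ->
  exists S, tabw S = v /\ tabp S = tabp T.
Proof.
move=> sv v_le; have sz : size v = size (tabp T) by rewrite sv size_tabp.
have u1 : abs (zip v (tabp T)) = v by rewrite -[LHS]/(unzip1 _) unzip1_zip // sz.
have u2 : map primed (zip v (tabp T)) = tabp T.
  by rewrite -[LHS]/(unzip2 _) unzip2_zip // sz.
exists (filling_of n la (zip v (tabp T))).
rewrite /tabw {2}/tabp revrow_filling_of ?u1 // /fits size_zip -sz minnn sv eqxx /=.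
by rewrite -(all_map absval (fun x => x <= n)) -/(abs _) u1; apply/allP.
Qed.

Lemma tabp_ext T U : (forall b, primed (entry T b) = primed (entry U b)) ->
  tabp T = tabp U.
Proof.
move=> h; apply: (factors_inj (la := la)); rewrite ?size_tabp // => k kla.
rewrite -[k]/(val (Ordinal kla)); apply: (can_inj revK); rewrite -!primed_trow.
by rewrite -!map_comp; apply: eq_map => j /=; apply: h.
Qed.

Lemma tabp_row_start T (i : 'I_(size la)) (j : 'I_(nth 0 la i)) :
  j.+1 = nth 0 la i ->
  nth false (tabp T) (sumn (take i la)) = primed (entry T (mkbox j)).
Proof.
have sz : size (rowfactor la (tabp T) i) = nth 0 la i.
  by rewrite -size_rev -primed_trow size_map size_trow.
move=> e; rewrite primed_entry nth_rev sz // e subnn.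
by rewrite /rowfactor nth_take ?nth_drop ?addn0 //; lia.
Qed.

Lemma strict_low T j : tabw T = low_word n la -> 0 < j <= n.-1 ->
  strict_at j 0 (tabw T).
Proof. by move=> -> jn; apply: strict_low_word => //; lia. Qed.

Lemma sigma_w0_high S : tabw S = high_word la -> tabw (sigma_w0 S) = low_word n la.
Proof.
move=> e; rewrite tabw_sigma_w0 // e; last exact: highest_high_word.
by rewrite fmaxs_w0word_high // prednK.
Qed.

Lemma ebar_high S i : tabw S = high_word la -> 1 <= i <= n.-1 -> tab_ebar i S = None.
Proof.
move=> e hi; apply/tab_ebar_None => //; rewrite e; first exact: highest_high_word.
exact: starts_low_zigzag_high.
Qed.

(** The preimage is built by hand from the word of T^highest and the primes of T, which sigma_w0
    preserves. *)
Lemma high_lift T : tabw T = low_word n la ->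
  exists2 S, tabw S = high_word la & sigma_w0 S = T.
Proof.
move=> e; have [||S [wS pS]] := @filling_with_abs T (high_word la).
- exact: size_high_word.
- by move=> x /high_word_le; lia.
exists S => //; apply: tabw_inj; first by rewrite sigma_w0_high.
by rewrite tabp_sigma_w0.
Qed.

Lemma sorted_geq_low T i : tabw T = low_word n la -> sorted geq (unprimed_row T i).
Proof.
move=> e; rewrite unprimed_rowE e nth_low_word // rev_nseq.
by elim: (nth 0 la i) => // -[|m] //= ->; rewrite leqnn.
Qed.

Lemma sorted_geq_high T i : tabw T = high_word la -> sorted geq (unprimed_row T i).
Proof.
move=> e; rewrite unprimed_rowE e nth_high_word // rev_sorted; exact: high_row_sorted.
Qed.

Lemma tabw_Tlowest_hat : tabw (Tlowest_hat n la) = low_word n la.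
Proof.
apply: (factors_inj (la := la)); rewrite ?size_tabw ?size_low_word // => k kla.
rewrite nth_low_word // -[k]/(val (Ordinal kla)) -[LHS]revK -unprimed_rowE.
suff -> : unprimed_row (Tlowest_hat n la) (Ordinal kla) = nseq (nth 0 la k) (n - k).
  by rewrite rev_nseq.
have sz : size (unprimed_row (Tlowest_hat n la) (Ordinal kla)) = nth 0 la k.
  by rewrite size_map size_trow.
rewrite -sz; apply/all_pred1P/allP => x /mapP[y /mapP[j _ ->] ->] /=.
by rewrite /entry /absval !ffunE /= inordK ?subSS //; lia.
Qed.

Lemma primed_Tlowest_hat b :
  primed (entry (Tlowest_hat n la) b) = ((tagged b).+1 == nth 0 la (tag b)).
Proof. by rewrite /entry !ffunE. Qed.

Lemma primed_Thighest b : primed (entry (Thighest n la) b) = false.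
Proof. by rewrite /entry !ffunE. Qed.

Lemma row_nonempty (i : 'I_(size la)) : exists j : 'I_(nth 0 la i), j.+1 = nth 0 la i.
Proof.
have lt : (nth 0 la i).-1 < nth 0 la i by rewrite prednK // nth_la_gt0.
by exists (Ordinal lt); rewrite /= prednK // nth_la_gt0.
Qed.

(** The letters of T^lowest are the n - k, each first read at the last box of its row; f_0^[n-k]
    vanishes exactly when that box is primed. *)
Lemma f0_low T : tabw T = low_word n la ->
  (forall i, 1 <= i <= n -> tab_f0_at i T = None) <->
  (forall b : box la, (tagged b).+1 = nth 0 la (tag b) -> primed (entry T b)).
Proof.
move=> e; have str := strict_low e.
split=> [h [i j] /= ej|h i hi].
  have hi : 0 < n - i <= n by have := ltn_ord i; lia.
  move: (h _ hi) => /(tab_f0_at_None n_gt0 hi str).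
  rewrite e index_low_word // last_in_low_word // => /(_ isT).
  by rewrite (tabp_row_start _ ej).
apply/(tab_f0_at_None n_gt0 hi str); rewrite e => /mem_low_word[k kla ->].
rewrite index_low_word //; have [j ej] := row_nonempty (Ordinal kla).
by rewrite (tabp_row_start _ ej); apply: h.
Qed.

Lemma e0_high T : tabw T = high_word la ->
  (forall i, 1 <= i <= n -> tab_e0_at i T = None) ->
  forall b : box la, (tagged b).+1 = nth 0 la (tag b) -> primed (entry T b) = false.
Proof.
move=> e h [i j] /= ej.
have hi : 0 < i.+1 <= n by have := ltn_ord i; lia.
move: (h _ hi); rewrite conj_op_None tab_e0_None // blockedE -/(tabw _) -/(tabp _).
have [v _] := @fmaxs_iota_high 1 i la isT la_srt.
rewrite tabp_sigmas tabw_sigmas ?e //; last first.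
  by apply/allP => k; rewrite mem_iota; have := ltn_ord i; lia.
have [-> ->] := @index_iota_high i la la_srt la_pos (ltn_ord i).
by rewrite (tabp_row_start _ ej) => /eqP.
Qed.

Lemma lowest_Tlowest_hat : DecTab (Tlowest_hat n la) /\ lowest_weight (Tlowest_hat n la).
Proof.
have e := tabw_Tlowest_hat; split.
  by apply: DecTab_low => // b; rewrite primed_Tlowest_hat => /eqP.
split=> [i hi|]; last by apply/f0_low => // b eb; rewrite primed_Tlowest_hat eb.
split; first by apply/tab_f_None; [lia|apply: strict_unmatched; apply: strict_low].
have [S eS wS] := high_lift e.
by apply/(tab_fbar'_None i wS); apply: ebar_high => //; lia.
Qed.

Lemma lowest_unique T : DecTab T -> lowest_weight T -> T = Tlowest_hat n la.
Proof.
move=> dT [low f0].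
have [|S hS wS] := @lowest_lift n la n_gt0 T; first by move=> i /low[].
have e : tabw T = low_word n la.
  apply: strict_low_rows => // j hj; rewrite -wS; apply: sigma_w0_strict => // i hi.
  (* The operator with index n - i on T corresponds to e_(bar i) on S. *)
  have hni : 1 <= n - i <= n.-1 by lia.
  have [_ /(tab_fbar'_None _ wS)] := low _ hni.
  by have -> : n - (n - i) = i by lia.
apply: tabw_inj; first by rewrite e tabw_Tlowest_hat.
apply: tabp_ext => b; rewrite primed_Tlowest_hat; apply/idP/eqP.
  by apply: low_primed_last => // i; apply: sorted_geq_low.
by move: b; apply/(f0_low e).
Qed.

Lemma highest_Thighest : DecTab (Thighest n la) /\ highest_weight (Thighest n la).
Proof.
have e := tabw_Thighest la_strict la_size; split.
  (* The hook conditions are checked on sigma_w0 of the tableau, whose rows are constant. *)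
  apply/DecTab_sigma_w0; apply: DecTab_low => //; first exact: sigma_w0_high.
  by case=> i j; rewrite primed_entry tabp_sigma_w0 // -primed_entry primed_Thighest.
split=> [i hi|i hi].
  by split; [apply/tab_e_None; rewrite e; apply: (@highest_high_word n.-1)|exact: ebar_high].
rewrite conj_op_None tab_e0_None // blockedE -/(tabp _) tabp_sigmas.
by rewrite tabp_Thighest // nth_nseq if_same implybT.
Qed.

Lemma highest_unique T : DecTab T -> highest_weight T -> T = Thighest n la.
Proof.
move=> dT [high e0].
have hT : highest_word n.-1 (tabw T) by apply/highest_wordP => i /high[].
have eU : tabw (sigma_w0 T) = low_word n la.
  apply: strict_low_rows => //; first exact/DecTab_sigma_w0.
  by move=> j hj; apply: sigma_w0_strict => // i /high[].
have [S eS wS] := high_lift eU.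
(* S and T have the same image under the injective sigma_w0, so T is S. *)
have e : tabw T = high_word la by rewrite -(sigma_w0_inj wS).
apply: tabw_inj; first by rewrite e tabw_Thighest.
apply: tabp_ext => b; rewrite primed_Thighest; apply/negP => pb.
have eb := low_primed_last dT (fun i => sorted_geq_high i e) pb.
by rewrite (e0_high e e0 eb) in pb.
Qed.

End Main.

Theorem mainTheorem2 (n : nat) (la : seq nat)
    (n_ge2 : 2 <= n) (la_strict : strict_partition la)
    (la_size : size la <= n) :
  unique (fun T : filling n la => DecTab T /\ highest_weight T)
    (Thighest n la) /\
  unique (fun T : filling n la => DecTab T /\ lowest_weight T)
    (Tlowest_hat n la).
Proof.
split; split.
- exact: highest_Thighest.
- by move=> T [dT hT]; rewrite (highest_unique n_ge2 la_strict la_size dT hT).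
- exact: lowest_Tlowest_hat.
- by move=> T [dT lT]; rewrite (lowest_unique n_ge2 la_strict la_size dT lT).
Qed.
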